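(* Let $\beta=(\pi_\ell)_{\ell=1}^L$ be a non-redundant chainable architecture of depth $L\ge 2$, let $\mathbf{A}\in\mathbb{C}^{m\times n}$ with $m=a_1b_1d_1$, $n=a_Lc_Ld_L$, and let $\sigma=(\sigma_1,\dots,\sigma_{L-1})$ be any permutation of $\{1,\dots,L-1\}$. Then the butterfly algorithm with inputs $(\mathbf{A},\beta,\sigma)$ returns $(\mathbf{X}_\ell)_{\ell=1}^L\in\Sigma^\beta$ such that $$\|\mathbf{A}-\mathbf{X}_1\cdots\mathbf{X}_L\|_F\le\sum_{k=1}^{L-1}E^{\beta_{\sigma_k}}(\mathbf{A}).$$
   Context: A pattern is a tuple $\pi=(a,b,c,d)$ of positive integers; $\mathbf{S}_\pi:=\mathbf{I}_a\otimes\mathbf{1}_{b\times c}\otimes\mathbf{I}_d\in\{0,1\}^{abd\times acd}$. A $\pi$-factor is a complex $abd\times acd$ matrix with support contained in that of $\mathbf{S}_\pi$; $\Sigma^\pi$ is the set of $\pi$-factors. Patterns $\pi_1=(a_1,b_1,c_1,d_1),\pi_2=(a_2,b_2,c_2,d_2)$ are chainable if $a_1c_1/a_2=b_2d_2/d_1=:r(\pi_1,\pi_2)$ is an integer, $a_1\mid a_2$, $d_2\mid d_1$; then $\pi_1*\pi_2:=(a_1,b_1d_1/d_2,a_2c_2/a_1,d_2)$; such a pair is redundant if $r(\pi_1,\pi_2)\ge\min(b_1,c_2)$. An architecture $\beta=(\pi_\ell)_{\ell=1}^L$ is a sequence of patterns with $a_\ell c_\ell d_\ell=a_{\ell+1}b_{\ell+1}d_{\ell+1}$;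 it is chainable if consecutive pairs are chainable and redundant if some consecutive pair is redundant. $\pi_{[p,q]}:=\pi_p*\cdots*\pi_q$ (iterated product, well defined for chainable $\beta$). $\Sigma^\beta:=\Sigma^{\pi_1}\times\cdots\times\Sigma^{\pi_L}$. For $s\in\{1,\dots,L-1\}$, $\beta_s:=(\pi_{[1,s]},\pi_{[s+1,L]})$ and $E^{\beta_s}(\mathbf{A}):=\min_{\mathbf{X}\in\Sigma^{\pi_{[1,s]}},\mathbf{Y}\in\Sigma^{\pi_{[s+1,L]}}}\|\mathbf{A}-\mathbf{X}\mathbf{Y}\|_F$. For binary $\mathbf{L},\mathbf{R}$ with $\mathbf{U}_i:=\mathbf{L}[:,i]\mathbf{R}[i,:]$, $\mathcal{P}(\mathbf{L},\mathbf{R})$ is the partition of column indices of $\mathbf{L}$ into classes of the relation $\mathbf{U}_i=\mathbf{U}_j$, and $R_P\times C_P$ is the support of $\mathbf{U}_i$ for $i\in P$. TwoFactor$(\mathbf{M},\pi,\pi')$: zero $\mathbf{X},\mathbf{Y}$ of $\pi$-, $\pi'$-factor sizes; for each $P\in\mathcal{P}(\mathbf{S}_\pi,\mathbf{S}_{\pi'})$ set $(\mathbf{X}[R_P,P],\mathbf{Y}[P,C_P])$ to any minimizer $(\mathbf{H},\mathbf{K})$ of $\|\mathbf{M}[R_P,C_P]-\mathbf{H}\mathbf{K}\|_F$ over $\mathbf{H}\in\mathbb{C}^{|R_P|\times|P|},\mathbf{K}\in\mathbb{C}^{|P|\times|C_P|}$. Ortho$(\pi,\pi',\mathbf{X},\mathbf{Y},u)$: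 zero $\tilde{\mathbf{X}},\tilde{\mathbf{Y}}$; for each $P\in\mathcal{P}(\mathbf{S}_\pi,\mathbf{S}_{\pi'})$: if $u=$ column, QR-decompose $\mathbf{X}[R_P,P]=\mathbf{Q}\mathbf{R}$ and set $\tilde{\mathbf{X}}[R_P,P]=\mathbf{Q}$, $\tilde{\mathbf{Y}}[P,C_P]=\mathbf{R}\mathbf{Y}[P,C_P]$; if $u=$ row, QR-decompose $\mathbf{Y}[P,C_P]^\top=\mathbf{Q}\mathbf{R}$ and set $\tilde{\mathbf{X}}[R_P,P]=\mathbf{X}[R_P,P]\mathbf{R}^\top$, $\tilde{\mathbf{Y}}[P,C_P]=\mathbf{Q}^\top$. Butterfly algorithm: keep consecutive intervals $I_1,\dots,I_J$ partitioning $\{1,\dots,L\}$ with factors $\mathbf{X}_{I_k}$, initially $I_1=[1,L]$, $\mathbf{X}_{I_1}=\mathbf{A}$. For $J=1,\dots,L-1$: $s=\sigma_J$, $j$ with $s\in I_j=[q,t]$; for $k=1,\dots,j-1$: $(\mathbf{X}_{I_k},\mathbf{X}_{I_{k+1}})\leftarrow$ Ortho$(\pi_{I_k},\pi_{I_{k+1}},\mathbf{X}_{I_k},\mathbf{X}_{I_{k+1}},\text{column})$; for $k=J,\dots,j+1$ (decreasing): $(\mathbf{X}_{I_{k-1}},\mathbf{X}_{I_k})\leftarrow$ Ortho$(\pi_{I_{k-1}},\pi_{I_k},\mathbf{X}_{I_{k-1}},\mathbf{X}_{I_k},\text{row})$; then $(\mathbf{X}_{[q,s]},\mathbf{X}_{[s+1,t]})\leftarrow$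 TwoFactor$(\mathbf{X}_{I_j},\pi_{[q,s]},\pi_{[s+1,t]})$ and $I_j$ is replaced by $[q,s],[s+1,t]$. Output $(\mathbf{X}_{[\ell,\ell]})_{\ell=1}^L$. *)

(* Defs.v *)
From HB Require Import structures.
From mathcomp Require Import all_boot all_order all_algebra.
From mathcomp Require Import complex.
From mathcomp Require Import classical_sets reals.

Set Implicit Arguments.
Unset Strict Implicit.
Unset Printing Implicit Defensive.

Import Order.TTheory GRing.Theory Num.Theory.
Local Open Scope ring_scope.

(* Patterns pi = (a,b,c,d) and their supports S_pi = I_a (x) 1_{bxc} (x) I_d *)

Record pattern := Pat { pa : nat; pb : nat; pc : nat; pd : nat }.

Definition pos_pattern (p : pattern) : bool :=
  [&& 0 < pa p, 0 < pb p, 0 < pc p & 0 < pd p]%N.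

Definition prows (p : pattern) : nat := (pa p * pb p * pd p)%N.
Definition pcols (p : pattern) : nat := (pa p * pc p * pd p)%N.

(* (i,j) (0-based) lies in the support of S_pi : writing
   i = i1*(b d) + i2*d + i3 and j = j1*(c d) + j2*d + j3,
   the entry of I_a (x) 1_{bxc} (x) I_d is [i1 = j1][i3 = j3]. *)
Definition supp (p : pattern) (i j : nat) : bool :=
  (i %/ (pb p * pd p) == j %/ (pc p * pd p))%N && (i %% pd p == j %% pd p)%N.

Definition chainable (p1 p2 : pattern) : Prop :=
  [/\ (pa p2 %| pa p1 * pc p1)%N, (pd p1 %| pb p2 * pd p2)%N,
      (pa p1 * pc p1 %/ pa p2 = pb p2 * pd p2 %/ pd p1)%N,
      (pa p1 %| pa p2)%N & (pd p2 %| pd p1)%N].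

Definition ratio (p1 p2 : pattern) : nat := (pa p1 * pc p1 %/ pa p2)%N.

Definition pat_mul (p1 p2 : pattern) : pattern :=
  Pat (pa p1) (pb p1 * pd p1 %/ pd p2) (pa p2 * pc p2 %/ pa p1) (pd p2).

Definition redundant_pair (p1 p2 : pattern) : Prop :=
  (minn (pb p1) (pc p2) <= ratio p1 p2)%N.

(* Architectures: beta = [:: pi_1; ...; pi_L], 1-based access          *)

Definition pat (beta : seq pattern) (l : nat) : pattern :=
  nth (Pat 1 1 1 1) beta l.-1.

Definition is_arch (beta : seq pattern) : Prop :=
  all pos_pattern beta /\
  forall l, (1 <= l < size beta)%N ->
    (pa (pat beta l) * pc (pat beta l) * pd (pat beta l) =
     pa (pat beta l.+1) * pb (pat beta l.+1) * pd (pat beta l.+1))%N.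

Definition chainable_arch (beta : seq pattern) : Prop :=
  forall l, (1 <= l < size beta)%N -> chainable (pat beta l) (pat beta l.+1).

Definition redundant_arch (beta : seq pattern) : Prop :=
  exists l, (1 <= l < size beta)%N /\ redundant_pair (pat beta l) (pat beta l.+1).

Definition prodpat (beta : seq pattern) (p q : nat) : pattern :=
  foldl (fun acc l => pat_mul acc (pat beta l)) (pat beta p) (iota p.+1 (q - p)).

Section Mx.
Variable R : realType.
Local Notation C := (R[i]).

(* Complex matrices of arbitrary size (the algorithm manipulates       *)
(* matrices of varying sizes); entries accessed by nat indices         *)
(* (0 outside the matrix).                                             *)

Record mxs := MX { nr : nat; nc : nat; mxof : 'M[C]_(nr, nc) }.

Definition ent (A : mxs) (i j : nat) : C :=
  match (insub i : option 'I_(nr A)), (insub j : option 'I_(nc A)) with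
  | Some i', Some j' => mxof A i' j'
  | _, _ => 0
  end.

Definition mx0 : mxs := MX (0 : 'M[C]_(0, 0)).

(* product (the inner dimension is nc A; equals nr B when well typed) *)
Definition mulx (A B : mxs) : mxs :=
  MX (\matrix_(i < nr A, j < nc B) \sum_(k < nc A) mxof A i k * ent B k j).

Definition subx (A B : mxs) : mxs :=
  MX (\matrix_(i < nr A, j < nc A) (mxof A i j - ent B i j)).

Definition prodx (xs : seq mxs) : mxs :=
  match xs with [::] => mx0 | x :: xs' => foldl mulx x xs' end.

Definition cnorm (z : C) : R := ComplexField.Normc.normc z.

Definition frob (A : mxs) : R :=
  Num.sqrt (\sum_(i < nr A) \sum_(j < nc A) cnorm (mxof A i j) ^+ 2).

Definition is_factor (p : pattern) (X : mxs) : Prop :=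
  [/\ nr X = prows p, nc X = pcols p &
      forall (i : 'I_(nr X)) (j : 'I_(nc X)), ~~ supp p i j -> mxof X i j = 0].

Definition in_Sigma (beta : seq pattern) (xs : seq mxs) : Prop :=
  size xs = size beta /\
  forall l, (1 <= l <= size beta)%N -> is_factor (pat beta l) (nth mx0 xs l.-1).

(* E^{beta_s}(A) = min over X in Sigma^{pi_[1,s]}, Y in Sigma^{pi_[s+1,L]}
   of ||A - XY||_F  (the minimum is attained; we use the infimum). *)
Definition Eerr (beta : seq pattern) (s : nat) (A : mxs) : R :=
  inf [set x : R | exists X Y, [/\ is_factor (prodpat beta 1 s) X,
                                    is_factor (prodpat beta s.+1 (size beta)) Y &
                                    x = frob (subx A (mulx X Y))]].

(* The partition P(S_pi, S_pi') of the column indices of S_pi.         *)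
(* U_i = S_pi[:,i] S_pi'[i,:]; i ~ j iff U_i = U_j.                    *)

Definition Uent (p p' : pattern) (i r c : nat) : bool :=
  [&& (r < prows p)%N, supp p r i, (c < pcols p')%N & supp p' i c].

Definition sameU (p p' : pattern) (i j : nat) : bool :=
  [forall r : 'I_(prows p), forall c : 'I_(pcols p'),
      Uent p p' i r c == Uent p p' j r c].

Definition inP (p p' : pattern) (i j : nat) : bool :=
  (j < pcols p)%N && sameU p p' i j.

(* R_P x C_P = support of U_i (i in P) *)
Definition inRP (p p' : pattern) (i r : nat) : bool :=
  [exists c : 'I_(pcols p'), Uent p p' i r c].
Definition inCP (p p' : pattern) (i c : nat) : bool :=
  [exists r : 'I_(prows p), Uent p p' i r c].

Definition block_supported (p p' : pattern) (X Y : mxs) : Prop :=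
  [/\ (nr X, nc X) = (prows p, pcols p), (nr Y, nc Y) = (prows p', pcols p'),
      (forall r j, ~~ inRP p p' j r -> ent X r j = 0) &
      (forall j c, ~~ inCP p p' j c -> ent Y j c = 0)].

Definition blockerr (p p' : pattern) (M : mxs) (i : nat) (H K : nat -> nat -> C) : R :=
  Num.sqrt (\sum_(r < prows p | inRP p p' i r) \sum_(c < pcols p' | inCP p p' i c)
     cnorm (ent M r c - \sum_(j < pcols p | inP p p' i j) H r j * K j c) ^+ 2).

(* TwoFactor(M, pi, pi') may return (X, Y) *)
Definition twofactor (p p' : pattern) (M X Y : mxs) : Prop :=
  block_supported p p' X Y /\
  forall i, (i < pcols p)%N -> forall H K : nat -> nat -> C,
    blockerr p p' M i (ent X) (ent Y) <= blockerr p p' M i H K.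

(* Ortho(pi, pi', X, Y, u) may return (X', Y') *)
Inductive odir := OCol | ORow.

Definition ortho (u : odir) (p p' : pattern) (X Y X' Y' : mxs) : Prop :=
  block_supported p p' X' Y' /\
  forall i, (i < pcols p)%N ->
  exists Q Rm : nat -> nat -> C,
    (forall j j', inP p p' i j -> inP p p' i j' -> (j' < j)%N -> Rm j j' = 0) /\
    match u with
    | OCol =>
      [/\
          forall j j', inP p p' i j -> inP p p' i j' ->
            \sum_(r < prows p | inRP p p' i r) conjc (Q r j) * Q r j' = (j == j')%:R,
          forall r j, inRP p p' i r -> inP p p' i j ->
            ent X r j = \sum_(j' < pcols p | inP p p' i j') Q r j' * Rm j' j,
          forall r j, inRP p p' i r -> inP p p' i j -> ent X' r j = Q r j &
          forall j c, inP p p' i j -> inCP p p' i c ->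
            ent Y' j c = \sum_(j' < pcols p | inP p p' i j') Rm j j' * ent Y j' c]
    | ORow =>
      [/\
          forall j j', inP p p' i j -> inP p p' i j' ->
            \sum_(c < pcols p' | inCP p p' i c) conjc (Q c j) * Q c j' = (j == j')%:R,
          forall j c, inP p p' i j -> inCP p p' i c ->
            ent Y j c = \sum_(j' < pcols p | inP p p' i j') Q c j' * Rm j' j,
          forall j c, inP p p' i j -> inCP p p' i c -> ent Y' j c = Q c j &
          forall r j, inRP p p' i r -> inP p p' i j ->
            ent X' r j = \sum_(j' < pcols p | inP p p' i j') ent X r j' * Rm j j']
    end.

(* The butterfly algorithm, as a relation (QR factors and minimizers    *)
(* are arbitrary choices).  A state is the list of the intervals        *)
(* I_1,...,I_J (as pairs (q,t), 1-based) with their factors X_{I_k}.    *)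

Definition state := seq ((nat * nat) * mxs).
Definition dflt_entry : (nat * nat) * mxs := ((0, 0)%N, mx0).

Definition ipat (beta : seq pattern) (I : nat * nat) : pattern := prodpat beta I.1 I.2.

Definition ortho_step (u : odir) (beta : seq pattern) (k : nat) (st st' : state) : Prop :=
  (1 <= k < size st)%N /\
  let e1 := nth dflt_entry st k.-1 in
  let e2 := nth dflt_entry st k in
  exists X' Y', ortho u (ipat beta e1.1) (ipat beta e2.1) e1.2 e2.2 X' Y' /\
    st' = set_nth dflt_entry (set_nth dflt_entry st k.-1 (e1.1, X')) k (e2.1, Y').

Fixpoint rel_seq (T : Type) (Rk : nat -> T -> T -> Prop) (ks : seq nat) (x y : T) : Prop :=
  match ks with
  | [::] => y = x
  | k :: ks' => exists z, Rk k x z /\ rel_seq Rk ks' z y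
  end.

Definition bstep (beta : seq pattern) (J s : nat) (st st' : state) : Prop :=
  exists j, (1 <= j <= size st)%N /\
  let q := (nth dflt_entry st j.-1).1.1 in
  let t := (nth dflt_entry st j.-1).1.2 in
  (q <= s <= t)%N /\
  exists st1 st2,
    rel_seq (ortho_step OCol beta) (iota 1 j.-1) st st1 /\
    rel_seq (ortho_step ORow beta) (rev (iota j (J - j))) st1 st2 /\
    exists X Y,
      twofactor (prodpat beta q s) (prodpat beta s.+1 t) (nth dflt_entry st2 j.-1).2 X Y /\
      st' = take j.-1 st2 ++ [:: ((q, s), X); ((s.+1, t), Y)] ++ drop j st2.

Definition butterfly (beta : seq pattern) (sigma : seq nat) (A : mxs) (out : seq mxs) : Prop :=
  exists stf : state,
    rel_seq (fun J => bstep beta J (nth 0%N sigma J.-1)) (iota 1 (size beta).-1)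
            [:: ((1, size beta)%N, A)] stf /\
    out = map snd stf.

End Mx.

(* Main.v *)
(* Index the boundaries between factors by [u = 0, ..., L].  For a cut [s], a
   matrix belongs to the products of [Sigma^{beta_s}] iff it vanishes off the
   global support and each of its disjoint blocks [R_P x C_P] has rank at most
   [|P|]; when the cut moves to the right the row sets of the blocks get coarser
   and the column sets finer.

   One step.  The QR passes make the product of the factors left of the split
   one column-orthonormal on each block, and the product of those on its right
   row-orthonormal.  Hence a best block approximation of the middle factor gives
   a best block approximation of the whole product [B], so the step moves [B] by
   at most its distance to [Sigma^{beta_s}].

   Monotonicity.  A best rank-[r] approximation [H K] of a block is both a left
   and a right orthogonal projection of it.  Replacing all [s]-blocks by their
   left (resp. right) projections is a linear contraction which maps the
   products of [Sigma^{beta_s'}] to themselves for [s' > s] (resp. [s' < s]), so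
   no step increases the distance to the cuts still to come.  Summing the steps
   gives the bound.

   The algorithm never gets stuck: QR factors with orthonormal columns exist
   because non-redundancy makes every class [P] no larger than [R_P] and [C_P],
   and best approximations exist by the spectral theorem and Ky Fan's argument. *)
Require Import Defs.
From mathcomp Require Import all_boot all_order all_algebra.
From mathcomp Require Import complex spectral sesquilinear.
From mathcomp Require Import boolp classical_sets reals.
From mathcomp Require Import zify lra ring.

Set Implicit Arguments.
Unset Strict Implicit.
Unset Printing Implicit Defensive.

Import Order.TTheory GRing.Theory Num.Theory.
Local Open Scope ring_scope.

(** * Orthonormal families and QR *)

(** All support combinatorics is expressed by two coordinates of an index at an interface: its
    level, which coarsens as the left end of an interval moves left, and its residue, which coarsens
    as the right end moves right. In a block at cut [s] the residue is read off the row and the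
    level off the column, and the class depends on [s] alone, not on the interval being split. Hence
    the blocks of a middle factor and those of the whole product are indexed by the same classes,
    which is what lets optimality pass from one to the other. Monotonicity is carried by witnesses
    rather than by infima: each admissible product compared with [A] has a counterpart at the same
    cut that is at least as close to the current product. The infimum is met only when one step is
    charged to [Eerr]. The input [A] need not vanish off the global support, so the initial state is
    not a product of factors; the first split, where both QR passes are empty, is treated apart.
    Matrices are handled as functions on [nat] with explicit inner dimensions, so that rebracketing
    products needs no casts. *)

Section LinearAlgebra.
Variable R : realType.
Local Notation C := (R[i]).
Local Notation sq z := (cnorm z ^+ 2).
Local Notation "x %:C" := (real_complex _ x) (format "x %:C") : ring_scope.

Lemma sqC (z : C) : (sq z)%:C = conjc z * z.
Proof. by rewrite mulrC -sqr_normc normc_def rmorphXn; case: z. Qed.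

Lemma cnorm0 : cnorm (0 : C) = 0.
Proof. exact: ComplexField.Normc.normc0. Qed.

Lemma sq0 : sq (0 : C) = 0. Proof. by rewrite cnorm0 expr0n. Qed.

Lemma cnormN (z : C) : cnorm (- z) = cnorm z.
Proof. exact: normcN. Qed.

Lemma sq_ge0 (z : C) : 0 <= sq z. Proof. exact: sqr_ge0. Qed.

Lemma sq_eq0 (z : C) : sq z = 0 -> z = 0.
Proof.
by move/eqP; rewrite sqrf_eq0 => /eqP; apply: ComplexField.Normc.eq0_normc.
Qed.

Lemma cnormJ (z : C) : cnorm (conjc z) = cnorm z.
Proof. by case: z => a b; rewrite /cnorm /= sqrrN. Qed.

Lemma conjc_sum (I : Type) (r : seq I) (P : pred I) (F : I -> C) :
  conjc (\sum_(i <- r | P i) F i) = \sum_(i <- r | P i) conjc (F i).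
Proof. exact: rmorph_sum. Qed.

Lemma sum_sq_eq0 (I : finType) (P : pred I) (F : I -> C) :
  \sum_(i | P i) sq (F i) <= 0 -> forall i, P i -> F i = 0.
Proof.
move=> le0 i Pi; apply: sq_eq0; apply/eqP.
have /eqP : \sum_(i | P i) sq (F i) = 0.
  by apply/eqP; rewrite eq_le le0 sumr_ge0 // => j _; apply: sq_ge0.
by rewrite psumr_eq0 => [/allP/(_ i (mem_index_enum _))/implyP/(_ Pi) //|j _]; apply: sq_ge0.
Qed.

Section Orthonormal.
Variables (I J : finType) (P : pred I) (T : pred J) (Q : I -> J -> C).
Hypothesis Qorth : forall j j', T j -> T j' ->
  \sum_(i | P i) conjc (Q i j) * Q i j' = (j == j')%:R.

(** [Q w] lies in the span of the frame, so its distance to [v] splits into the part of [v]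
    orthogonal to the frame and the mismatch of coordinates. The case [v = 0] is the isometry
    property; the case where [w] is the coordinate vector of [v] is Bessel's inequality. *)
Lemma pythagoras (v : I -> C) (w : J -> C) :
  \sum_(i | P i) sq (v i - \sum_(j | T j) Q i j * w j) =
  \sum_(i | P i) sq (v i)
  - \sum_(j | T j) sq (\sum_(i | P i) conjc (Q i j) * v i)
  + \sum_(j | T j) sq (\sum_(i | P i) conjc (Q i j) * v i - w j).
Proof.
pose y j := \sum_(i | P i) conjc (Q i j) * v i.
pose z i := \sum_(j | T j) Q i j * w j.
have e1 : \sum_(i | P i) conjc (v i) * z i = \sum_(j | T j) conjc (y j) * w j.
  under eq_bigr do rewrite mulr_sumr.
  rewrite exchange_big; apply: eq_bigr => j Tj; rewrite conjc_sum mulr_suml.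
  by apply: eq_bigr => i Pi; rewrite rmorphM /= conjcK mulrA [conjc _ * Q _ _]mulrC.
have e2 : \sum_(i | P i) conjc (z i) * v i = \sum_(j | T j) conjc (w j) * y j.
  under eq_bigr do rewrite conjc_sum mulr_suml.
  rewrite exchange_big; apply: eq_bigr => j Tj; rewrite mulr_sumr.
  by apply: eq_bigr => i Pi; rewrite rmorphM /= mulrA [conjc (w j) * _]mulrC.
have e3 : \sum_(i | P i) conjc (z i) * z i = \sum_(j | T j) conjc (w j) * w j.
  under eq_bigr do rewrite conjc_sum mulr_suml.
  rewrite exchange_big; apply: eq_bigr => j Tj.
  under eq_bigr do rewrite mulr_sumr.
  rewrite exchange_big (bigD1 j) //= [X in _ + X]big1 ?addr0 => [|j' /andP[Tj' nj]].
    transitivity ((\sum_(i | P i) conjc (Q i j) * Q i j) * (conjc (w j) * w j)).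
      rewrite mulr_suml; apply: eq_bigr => i _; rewrite rmorphM /=.
      by rewrite mulrACA.
    by rewrite Qorth // eqxx mul1r.
  transitivity ((\sum_(i | P i) conjc (Q i j) * Q i j') * (conjc (w j) * w j')).
    by rewrite mulr_suml; apply: eq_bigr => i _; rewrite rmorphM /= mulrACA.
  by rewrite Qorth // eq_sym (negPf nj) mul0r.
(* Embedded in the complex numbers, squared moduli become [conjc z * z] and expand bilinearly. *)
apply: (@complexI R); rewrite rmorphD rmorphB !rmorph_sum /=.
under eq_bigr do rewrite sqC rmorphB mulrBl !mulrBr.
under [X in _ = X - _ + _]eq_bigr do rewrite sqC.
under [X in _ = _ - X + _]eq_bigr do rewrite sqC.
under [X in _ = _ - _ + X]eq_bigr do rewrite sqC rmorphB mulrBl !mulrBr.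
rewrite !sumrB e1 e2 e3 -/(y _).
rewrite -/y; set a := \sum_(i | P i) _; set b := \sum_(i | _) conjc (y i) * w i.
set c := \sum_(j | T j) conjc (w j) * y j.
set d := \sum_(j | T j) conjc (w j) * w j.
rewrite -/(y _); set e := \sum_(j | T j) conjc (y j) * y j.
by rewrite -!addrA; congr (_ + _); rewrite !addrA addNr add0r.
Qed.

Lemma isometry_sum (w : J -> C) :
  \sum_(i | P i) sq (\sum_(j | T j) Q i j * w j) = \sum_(j | T j) sq (w j).
Proof.
have := pythagoras (fun=> 0) w.
under eq_bigr do rewrite sub0r cnormN.
move=> ->; rewrite big1 ?sub0r => [|*]; last exact: sq0.
have y0 j : \sum_(i | P i) conjc (Q i j) * 0 = 0 :> C.
  by rewrite big1 // => i _; rewrite mulr0.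
rewrite big1 ?oppr0 ?add0r => [|j _]; last by rewrite y0 sq0.
by apply: eq_bigr => j _; rewrite y0 sub0r cnormN.
Qed.

Lemma bessel (v : I -> C) :
  \sum_(j | T j) sq (\sum_(i | P i) conjc (Q i j) * v i) <= \sum_(i | P i) sq (v i).
Proof.
have := pythagoras v (fun j => \sum_(i | P i) conjc (Q i j) * v i).
rewrite [X in _ + X]big1 ?addr0 => [h|j _]; last by rewrite subrr sq0.
by rewrite -subr_ge0 -h; apply: sumr_ge0 => i _; apply: sq_ge0.
Qed.

End Orthonormal.

Lemma ent_ord (n m : nat) (A : 'M[C]_(n, m)) (i : 'I_n) (j : 'I_m) :
  ent (MX A) i j = A i j.
Proof. by rewrite /ent /= !valK. Qed.

(** [enum T] lists ordinals in increasing order. This carries triangularity, proved on ranks, back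
    to the original indices. *)
Lemma lt_enum_rank_in (n : nat) (T : pred 'I_n) (x j j' : 'I_n) (Tx : x \in T) :
  j \in T -> j' \in T -> (j' < j)%N -> (enum_rank_in Tx j' < enum_rank_in Tx j)%N.
Proof.
move=> Tj Tj' lt; rewrite ltnNge; apply/negP => le.
have so : sorted ltn (map val (enum T)).
  rewrite /enum_mem -enumT /=.
  apply: (subseq_sorted ltn_trans (map_subseq _ (filter_subseq _ _))).
  by rewrite val_enum_ord iota_ltn_sorted.
have so' : sorted (relpre val ltn) (enum T) by rewrite -sorted_map.
have ne : enum_rank_in Tx j != enum_rank_in Tx j'.
  apply: contraTN lt => /eqP e; move: (enum_rankK_in Tx Tj').
  by rewrite -e enum_rankK_in // => ->; rewrite ltnn.
have lt2 : (enum_rank_in Tx j < enum_rank_in Tx j')%N by rewrite ltn_neqAle ne.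
have := @sorted_ltn_nth _ _ (fun a b c : 'I_n => @ltn_trans a b c) x _ so'
  (enum_rank_in Tx j) (enum_rank_in Tx j').
rewrite !inE -!cardE !ltn_ord => /(_ isT isT lt2) /=.
rewrite -!(enum_val_nth x) !enum_rankK_in //.
by rewrite ltnNge ltnW.
Qed.

(** Gram-Schmidt on the compressed block. The cardinality bound leaves room for [#|T|] orthonormal
    vectors even when the columns of [X] are dependent. *)
Lemma qr_exists (n p : nat) (P : pred 'I_n) (T : pred 'I_p) (X : nat -> nat -> C) :
  (#|T| <= #|P|)%N ->
  exists Q Rm : nat -> nat -> C,
  [/\ forall j j' : 'I_p, T j -> T j' -> (j' < j)%N -> Rm j j' = 0,
      forall j j' : 'I_p, T j -> T j' ->
        \sum_(r < n | P r) conjc (Q r j) * Q r j' = (j == j')%:R &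
      forall (r : 'I_n) (j : 'I_p), P r -> T j ->
        X r j = \sum_(j' < p | T j') Q r j' * Rm j' j].
Proof.
move=> TP; case: (pickP T) => [j0 Tj0|T0]; last first.
  by exists (fun _ _ => 0), (fun _ _ => 0); split=> [j|j|r j _]; rewrite T0.
have [i0 Pi0] : exists i0, i0 \in P.
  by apply/card_gt0P; apply: leq_trans TP; apply/card_gt0P; exists j0.
have {}Tj0 : j0 \in T by [].
(* [schmidt] orthonormalises rows, hence the transposed block. *)
pose A : 'M[C]_(#|T|, #|P|) := \matrix_(a < #|T|, b < #|P|) X (enum_val b : 'I_n) (enum_val a : 'I_p).
pose S := schmidt A.
have Su : S \is unitarymx by apply: schmidt_unitarymx.
have Sorth a a' : \sum_b conjc (S a b) * S a' b = (a == a')%:R.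
  have /matrixP/(_ a' a) := unitarymxP Su; rewrite !mxE eq_sym => <-.
  by apply: eq_bigr => b _; rewrite !mxE mulrC.
pose W := A *m (S ^t conjc)%sesqui.
have AW : A = W *m S.
  by rewrite /W; have /submxP[D ->] := schmidt_sub A; rewrite mulmxtVK.
(* Row [a] of [A] lies in the span of the rows of [S] of index at most [a], all orthogonal to row
   [a']. *)
have Wtri (a a' : 'I_#|T|) : (a < a')%N -> W a a' = 0.
  move=> lt; have -> : W a a' = (row a A *m (row a' S ^t conjc)%sesqui) 0 0.
    by rewrite !mxE; apply: eq_bigr => b _; rewrite !mxE.
  have /sub_sumsmxP[u ->] := row_schmidt_sub A a.
  rewrite mulmx_suml summxE big1 // => k le.
  have : (u k *m <<row k (schmidt A)>> <= row k S)%MS.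
    by rewrite (submx_trans (submxMl _ _)) // genmxE.
  case/submxP => D ->; rewrite -mulmxA mxE big1 // => b _.
  rewrite !mxE (_ : \sum_j _ = 0) ?mulr0 //.
  transitivity ((a' == k)%:R : C); last first.
    by rewrite -val_eqE gtn_eqF // (leq_ltn_trans le).
  by rewrite -Sorth; apply: eq_bigr => c _; rewrite !mxE mulrC.
pose rj := enum_rank_in Tj0; pose ri := enum_rank_in Pi0.
(* Back to the original indices; the entries outside [T] and [P] are junk that is never read. *)
pose Qm : 'M[C]_(n, p) := \matrix_(i, j) S (rj j) (ri i).
pose Rmm : 'M[C]_(p, p) := \matrix_(j, j') W (rj j') (rj j).
exists (ent (MX Qm)), (ent (MX Rmm)); split.
- move=> j j' Tj Tj' lt; rewrite ent_ord mxE Wtri //.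
  exact: lt_enum_rank_in.
- move=> j j' Tj Tj'.
  under eq_bigr do rewrite !ent_ord !mxE.
  rewrite -(big_enum_rank Pi0 (fun b => conjc (S (rj j) b) * S (rj j') b)) Sorth.
  congr (nat_of_bool _)%:R; apply/eqP/eqP => [e|-> //].
  by rewrite -(enum_rankK_in Tj0 Tj) -(enum_rankK_in Tj0 Tj') -/rj e.
- move=> r j Pr Tj.
  under eq_bigr do rewrite !ent_ord [Qm _ _]mxE [Rmm _ _]mxE.
  rewrite -(big_enum_rank Tj0 (fun a => S a (ri r) * W (rj j) a)).
  have /matrixP/(_ (rj j) (ri r)) := AW; rewrite !mxE /rj /ri !enum_rankK_in // => ->.
  by apply: eq_bigr => a _; rewrite mulrC.
Qed.

End LinearAlgebra.

(** * Best low-rank approximation *)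

Section BestApprox.
Variable R : realType.
Local Notation C := (R[i]).
Local Notation sq z := (cnorm z ^+ 2).
Local Notation "x %:C" := (real_complex _ x) (format "x %:C") : ring_scope.

Lemma sum_codom (r n : nat) (f : 'I_r -> 'I_n) (F : 'I_n -> R) : injective f ->
  \sum_i F i = \sum_j F (f j) + \sum_(i | i \notin codom f) F i.
Proof.
move=> fi; rewrite (bigID (mem (codom f))) /=; congr (_ + _).
transitivity (\sum_(i in f @: predT) F i).
  apply: eq_bigl => i; apply/codomP/imsetP => [[x ->]|[x _ ->]]; last by exists x.
  by exists x; rewrite ?inE.
by rewrite big_imset /= => [|x y _ _]; [|exact: fi].

Qed.

(* Multiplying both sides by the total mass moved avoids choosing a threshold
   between the values of [lam] inside and outside the range of [f]. *)
Lemma weighted_sum_le_top (n r : nat) (lam w : 'I_n -> R) (f : 'I_r -> 'I_n) :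
  injective f -> (forall i, 0 <= lam i) ->
  (forall i j, i \notin codom f -> lam i <= lam (f j)) ->
  (forall i, 0 <= w i <= 1) -> \sum_i w i = r%:R ->
  \sum_i lam i * w i <= \sum_j lam (f j).
Proof.
move=> fi lam0 ftop w01 sw.
set lo := \sum_(i | i \notin codom f) lam i * w i.
set hi := \sum_j lam (f j) * (1 - w (f j)).
suff : lo <= hi.
  rewrite (sum_codom _ fi) -/lo => le.
  rewrite -lerBrDl -sumrB; apply: le_trans le _; rewrite le_eqVlt; apply/orP; left.
  by apply/eqP; apply: eq_bigr => j _; rewrite mulrBr mulr1.
pose t := \sum_(i | i \notin codom f) w i.
have tE : t = \sum_j (1 - w (f j)).
  move: sw; rewrite (sum_codom _ fi) -/t sumrB sumr_const card_ord => <-.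
  by rewrite addrAC subrr add0r.
have t0 : 0 <= t by apply: sumr_ge0 => i _; case/andP: (w01 i).
have hi0 : 0 <= hi.
  apply: sumr_ge0 => j _; apply: mulr_ge0 => //.
  by rewrite subr_ge0; case/andP: (w01 (f j)).
have [t_eq0|t_neq0] := eqVneq t 0.
  suff -> : lo = 0 by [].
  apply: big1 => i ni; have /eqP := t_eq0.
  rewrite psumr_eq0 => [|j _]; last by case/andP: (w01 j).
  by move=> /allP/(_ i (mem_index_enum _))/implyP/(_ ni)/eqP ->; rewrite mulr0.
have tp : 0 < t by rewrite lt_def t_neq0.
rewrite -(ler_pM2l tp) {1}tE /t !mulr_suml.
under eq_bigr do rewrite mulr_sumr.
under [X in _ <= X]eq_bigr do rewrite mulr_sumr.
rewrite exchange_big; apply: ler_sum => i ni; apply: ler_sum => j _.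
have [/andP[wi _] /andP[_ wj]] := (w01 i, w01 (f j)).
rewrite [w i * _]mulrC mulrAC [X in _ <= X]mulrC.
by rewrite ler_wpM2l ?subr_ge0 // ler_wpM2r // ftop.
Qed.

Lemma sum_sqC (m : nat) (v : 'I_m -> C) :
  (\sum_c sq (v c))%:C = \sum_c v c * conjc (v c).
Proof. by rewrite rmorph_sum; apply: eq_bigr => c _; rewrite /= sqC mulrC. Qed.

(** By QR a competitor may be taken with orthonormal [H]; its least error is then the squared norm
    of [M] minus the energy captured by the frame. In the eigenbasis of [G] this energy is a
    combination of eigenvalues with weights in [0,1] of total [r], so the [r] leading eigenvectors
    are best. *)
Lemma best_approx_mx (n m r : nat) (M : 'M[C]_(n, m)) : (r <= n)%N ->
  exists (H : 'M[C]_(n, r)) (K : 'M[C]_(r, m)),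
  forall (H' : 'M[C]_(n, r)) (K' : 'M[C]_(r, m)),
    \sum_c \sum_i sq (M i c - (H *m K) i c) <=
    \sum_c \sum_i sq (M i c - (H' *m K') i c).
Proof.
move=> rn; pose G := M *m (M ^t conjc)%sesqui.
have tM n1 n2 n3 (X : 'M[C]_(n1, n2)) (Y : 'M[C]_(n2, n3)) :
    ((X *m Y) ^t conjc)%sesqui = (Y ^t conjc)%sesqui *m (X ^t conjc)%sesqui.
  by rewrite trmx_mul map_mxM.
have tK n1 n2 (X : 'M[C]_(n1, n2)) : ((X ^t conjc) ^t conjc)%sesqui = X.
  by apply/matrixP => i j; rewrite !mxE conjcK.
have Gn : G \is normalmx by apply/normalmxP; rewrite tM tK.
pose U := spectralmx G; have Uu : U \is unitarymx := spectral_unitarymx G.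
have UU : U *m (U ^t conjc)%sesqui = 1%:M := unitarymxP Uu.
have UU' : (U ^t conjc)%sesqui *m U = 1%:M by apply: mulmx1C.
(* In the eigenbasis the rows of the matrix are pairwise orthogonal, and their squared lengths [lam]
   are the eigenvalues of [G]. *)
pose N := U *m M; pose sp := spectral_diag G.
have NN : N *m (N ^t conjc)%sesqui = diag_mx sp.
  rewrite tM mulmxA -(mulmxA U) -/G (orthomx_spectralP Gn) -/U -/sp.
  rewrite invmx_unitary // !mulmxA.
  have -> : (U ^t Num.conj)%sesqui = (U ^t conjc)%sesqui by [].
  by rewrite UU mul1mx -mulmxA UU mulmx1.
pose lam i := \sum_c sq (N i c).
have lamE i : (lam i)%:C = sp 0 i.
  have /matrixP/(_ i i) := NN; rewrite !mxE eqxx mulr1n => <-.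
  by rewrite sum_sqC; apply: eq_bigr => c _; rewrite !mxE.
have lam0 i : 0 <= lam i by apply: sumr_ge0 => c _; apply: sq_ge0.
pose energy (Q : 'M[C]_(n, r)) :=
  \sum_c \sum_j sq (\sum_i conjc (Q i j) * M i c).
have energyE Q : energy Q = \sum_i lam i * \sum_j sq ((U *m Q) i j).
  apply: (@complexI R); rewrite /energy exchange_big /=.
  pose W := U *m Q.
  have QM : (Q ^t conjc)%sesqui *m M = (W ^t conjc)%sesqui *m N.
    by rewrite tM -mulmxA (mulmxA _ U) UU' mul1mx.
  rewrite !rmorph_sum /=.
  transitivity (\sum_j (((W ^t conjc)%sesqui *m N) *m
  (((W ^t conjc)%sesqui *m N) ^t conjc)%sesqui) j j).
    apply: eq_bigr => j _; rewrite sum_sqC -QM !mxE; apply: eq_bigr => c _.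
    have -> : \sum_i conjc (Q i j) * M i c = ((Q ^t conjc)%sesqui *m M) j c.
      by rewrite !mxE; apply: eq_bigr => i _; rewrite !mxE.
    by rewrite !mxE.
  rewrite (tM _ _ _ (W ^t conjc)%sesqui N) tK mulmxA -(mulmxA _ N) NN.
  transitivity (\sum_j \sum_i conjc (W i j) * (lam i)%:C * W i j).
    apply: eq_bigr => j _; rewrite mxE; apply: eq_bigr => i _.
    by rewrite mul_mx_diag !mxE -lamE.
  rewrite exchange_big; apply: eq_bigr => i _; rewrite rmorphM [X in _ = _ * X]rmorph_sum /= mulr_sumr.
  by apply: eq_bigr => j _; rewrite /= sqC mulrAC mulrC.
have energy_le (Q : 'M[C]_(n, r)) (f : 'I_r -> 'I_n) : injective f ->
    (forall i j, i \notin codom f -> lam i <= lam (f j)) ->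
    (forall j j', \sum_i conjc (Q i j) * Q i j' = (j == j')%:R) ->
    energy Q <= \sum_j lam (f j).
  move=> fi ftop Qo; rewrite energyE; apply: weighted_sum_le_top => //.
    move=> i; apply/andP; split; first by apply: sumr_ge0 => j _; apply: sq_ge0.
    (* A weight is the squared norm of the coordinates of a unit row of [U] in the frame [Q], hence
       at most 1. *)
    have := @bessel _ _ _ predT predT Q (fun j j' _ _ => Qo j j') (fun k => conjc (U i k)).
    have -> : \sum_k sq (conjc (U i k)) = 1.
      apply: (@complexI R); under eq_bigr do rewrite cnormJ.
      rewrite sum_sqC; transitivity ((1%:M : 'M[C]_n) i i); last by rewrite mxE eqxx.
      by rewrite -UU mxE; apply: eq_bigr => c _; rewrite !mxE.
    apply: le_trans; apply: ler_sum => j _.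
    rewrite -(cnormJ (\sum_i0 _)) conjc_sum mxE.
    under [X in _ <= cnorm X ^+ _]eq_bigr do rewrite rmorphM /= !conjcK mulrC.
    exact: lexx.
  (* The weights total [r] because each of the [r] columns of [U Q] is a unit vector. *)
  rewrite exchange_big /=.
  under eq_bigr => j _.
    have -> : \sum_i sq ((U *m Q) i j) = 1.
      have Uo : forall k k', predT k -> predT k' ->
          \sum_(i | predT i) conjc (U i k) * U i k' = (k == k')%:R :> C.
        move=> k k' _ _; have /matrixP/(_ k k') := UU'; rewrite !mxE => <-.
        by apply: eq_bigr => i _; rewrite !mxE.
      under eq_bigr do rewrite mxE.
      rewrite (isometry_sum Uo (fun k => Q k j)).
      apply: (@complexI R); rewrite rmorph_sum rmorph1.
      under eq_bigr do rewrite /= sqC.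
      by rewrite Qo eqxx.
    over.
  by rewrite sumr_const card_ord.
have errE (Q : 'M[C]_(n, r)) (K : 'M[C]_(r, m)) :
    (forall j j', \sum_i conjc (Q i j) * Q i j' = (j == j')%:R) ->
    \sum_c \sum_i sq (M i c - (Q *m K) i c) =
    \sum_c \sum_i sq (M i c) - energy Q
      + \sum_c \sum_j sq (\sum_i conjc (Q i j) * M i c - K j c).
  move=> Qo; rewrite /energy -sumrB -big_split /=; apply: eq_bigr => c _.
  rewrite -(@pythagoras _ _ _ predT predT Q (fun j j' _ _ => Qo j j')).
  by apply: eq_bigr => i _; rewrite !mxE.
have [f fi ftop] : exists2 f : 'I_r -> 'I_n, injective f &
    forall i j, i \notin codom f -> lam i <= lam (f j).
  (* [f] maximises the selected sum among the finitely many injections. Exchanging one selected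
     index for an unselected one cannot increase the sum, so the selection is a top one. *)
  pose f0 : {ffun 'I_r -> 'I_n} := [ffun j => widen_ord rn j].
  have f0i : injectiveb f0.
    apply/injectiveP => x y; rewrite !ffunE => /(congr1 val) /= e.
    exact: val_inj.
  case: (@Order.TotalTheory.arg_maxP _ R _ f0 (fun f : {ffun _ -> _} => injectiveb f)
           (fun f : {ffun _ -> _} => \sum_j lam (f j)) f0i) => f /injectiveP fi fmax.
  exists f => // i j0 ni.
  pose g : {ffun 'I_r -> 'I_n} := [ffun j => if j == j0 then i else f j].
  have gi : injectiveb g.
    apply/injectiveP => x y; rewrite !ffunE.
    case: eqVneq => [->|nx]; case: eqVneq => [->|ny] // e.
    - by case/negP: ni; rewrite e codom_f.
    - by case/negP: ni; rewrite -e codom_f.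
    - exact: fi.
  have := fmax g gi; rewrite (bigD1 j0 (F := fun j => lam (g j))) //=.
  rewrite (bigD1 j0 (F := fun j => lam (f j))) //= {1}ffunE eqxx.
  suff -> : \sum_(j | j != j0) lam (g j) = \sum_(j | j != j0) lam (f j).
    by rewrite lerD2r.
  by apply: eq_bigr => j nj; rewrite ffunE (negPf nj).
pose H : 'M[C]_(n, r) := \matrix_(i, j) conjc (U (f j) i).
have Ho j j' : \sum_i conjc (H i j) * H i j' = (j == j')%:R.
  have /matrixP/(_ (f j) (f j')) := UU; rewrite !mxE (inj_eq fi) => <-.
  by apply: eq_bigr => i _; rewrite !mxE conjcK.
have He : energy H = \sum_j lam (f j).
  rewrite /energy exchange_big /=; apply: eq_bigr => j _; apply: eq_bigr => c _.
  by congr (cnorm _ ^+ 2); rewrite [RHS]mxE; apply: eq_bigr => i _; rewrite mxE conjcK.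
(* These are the exact coordinates of [M] in the frame [H], so the mismatch term of [errE]
   vanishes. *)
exists H, ((H ^t conjc)%sesqui *m M) => H' K'.
rewrite (errE _ _ Ho) [X in _ + X]big1 ?addr0 => [|c _]; last first.
  rewrite big1 // => j _; have -> : ((H ^t conjc)%sesqui *m M) j c =
      \sum_i conjc (H i j) * M i c.
    by rewrite mxE; apply: eq_bigr => i _; rewrite mxE mxE.
  by rewrite subrr sq0.
have cardT : (#|(predT : pred 'I_r)| <= #|(predT : pred 'I_n)|)%N by rewrite !card_ord.
have [Q [Rm [_ Qo HQ]]] := qr_exists (ent (MX H')) cardT.
pose Qm : 'M[C]_(n, r) := \matrix_(i, j) Q i j.
pose Rmm : 'M[C]_r := \matrix_(i, j) Rm i j.
have -> : H' = Qm *m Rmm.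
  apply/matrixP => i j; rewrite -ent_ord HQ // !mxE.
  by apply: eq_bigr => k _; rewrite !mxE.
have Qmo j j' : \sum_i conjc (Qm i j) * Qm i j' = (j == j')%:R.
  by rewrite -Qo //; apply: eq_bigr => i _; rewrite !mxE.
rewrite -mulmxA errE // ler_wpDr //.
  by apply: sumr_ge0 => c _; apply: sumr_ge0 => j _; apply: sq_ge0.
by rewrite lerD2l lerN2 He; apply: energy_le.
Qed.

End BestApprox.

(** * Best approximation of a single block *)

Section BlockApprox.
Variable R : realType.
Local Notation C := (R[i]).
Local Notation sq z := (cnorm z ^+ 2).

(** The square of [blockerr], with free row, column and class predicates: one notion serves the
    middle factor, the whole product and their transposes. *)
Definition berr (n m p : nat) (P D T : pred nat) (M H K : nat -> nat -> C) : R :=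
  \sum_(i < n | P i) \sum_(c < m | D c)
    sq (M i c - \sum_(j < p | T j) H i j * K j c).

Lemma berr_ge0 n m p P D T M H K : 0 <= berr n m p P D T M H K.
Proof. by apply: sumr_ge0 => i _; apply: sumr_ge0 => c _; apply: sq_ge0. Qed.

Lemma berr_tr n m p P D T M H K :
  berr n m p P D T M H K =
  berr m n p D P T (fun c i => M i c) (fun c j => K j c) (fun j i => H i j).
Proof.
rewrite /berr exchange_big; apply: eq_bigr => c _; apply: eq_bigr => i _.
by congr (cnorm (_ - _) ^+ 2); apply: eq_bigr => j _; rewrite mulrC.
Qed.

Definition bopt n m p P D T M H K := forall H' K',
  berr n m p P D T M H K <= berr n m p P D T M H' K'.

(** Lets right projections be obtained from left ones. *)
Lemma bopt_tr n m p P D T M H K : bopt n m p P D T M H K ->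
  bopt m n p D P T (fun c i => M i c) (fun c j => K j c) (fun j i => H i j).
Proof.
move=> h H' K'; rewrite -berr_tr.
by have := h (fun i j => K' j i) (fun j c => H' c j); rewrite [leRHS]berr_tr.
Qed.

(** The class is compressed to [#|T|] indices and [M] is replaced by zero outside the block. A
    competitor truncated in the same way then has no error there, so the full-matrix optimum is also
    optimal on the block. *)
Lemma best_approx_block (n m p : nat) (P D T : pred nat) (M : nat -> nat -> C) :
  (#|[pred j : 'I_p | T j]| <= n)%N ->
  exists H K : nat -> nat -> C, bopt n m p P D T M H K.
Proof.
set Tp := [pred j : 'I_p | T j] => Tn.
case: (pickP Tp) => [j0 Tj0|T0]; last first.
  exists (fun _ _ => 0), (fun _ _ => 0) => H' K'; rewrite le_eqVlt; apply/orP; left.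
  apply/eqP; apply: eq_bigr => i _; apply: eq_bigr => c _.
  by rewrite !big1 // => j; have := T0 j => /= ->.
have {}Tj0 : j0 \in Tp by [].
pose M1 : 'M[C]_(n, m) := \matrix_(i, c) (if P i && D c then M i c else 0).
have [H1 [K1 opt]] := best_approx_mx M1 Tn.
pose rj := enum_rank_in Tj0.
pose H2 : 'M[C]_(n, p) := \matrix_(i, j) H1 i (rj j).
pose K2 : 'M[C]_(p, m) := \matrix_(j, c) K1 (rj j) c.
exists (ent (MX H2)), (ent (MX K2)) => H' K'.
pose H3 : 'M[C]_(n, #|Tp|) := \matrix_(i < n, a < #|Tp|) (if P i then H' i (enum_val a : 'I_p) else 0).
pose K3 : 'M[C]_(#|Tp|, m) := \matrix_(a < #|Tp|, c < m) (if D c then K' (enum_val a : 'I_p) c else 0).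
apply: (@le_trans _ _ (\sum_c \sum_i sq (M1 i c - (H1 *m K1) i c))).
  rewrite exchange_big /= /berr big_mkcond; apply: ler_sum => i _.
  case: ifP => Pi; last by apply: sumr_ge0 => c _; apply: sq_ge0.
  rewrite big_mkcond; apply: ler_sum => c _; case: ifP => Dc; last exact: sq_ge0.
  rewrite !mxE Pi Dc (big_enum_rank Tj0) -/rj.
  rewrite le_eqVlt; apply/orP; left; apply/eqP; congr (cnorm (_ - _) ^+ 2).
  by apply: eq_bigr => j Tj; rewrite !ent_ord !mxE.
apply: le_trans (opt H3 K3) _.
rewrite exchange_big /= /berr [leRHS]big_mkcond; apply: ler_sum => i _.
case: ifP => Pi; last first.
  rewrite big1 // => c _; rewrite !mxE Pi /= big1 ?subrr ?sq0 // => a _.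
  by rewrite !mxE Pi mul0r.
rewrite [leRHS]big_mkcond; apply: ler_sum => c _; case: ifP => Dc; last first.
  rewrite !mxE Pi Dc /= big1 ?subrr ?sq0 // => a _.
  by rewrite !mxE Dc mulr0.
rewrite !mxE Pi Dc (big_enum_val (A := Tp) (fun j : 'I_p => H' i j * K' j c)) /=.
rewrite le_eqVlt; apply/orP; left; apply/eqP; congr (cnorm (_ - _) ^+ 2).
by apply: eq_bigr => a _; rewrite !mxE Pi Dc.
Qed.

(* By QR the columns of an optimal [H] lie in an orthonormal frame [Q], and the
   Pythagorean identity forces [H K] to be the orthogonal projection of [M]. *)
Lemma bopt_projection (n m p : nat) (P D T : pred nat) (M H K : nat -> nat -> C) :
  (#|[pred j : 'I_p | T j]| <= #|[pred i : 'I_n | P i]|)%N ->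
  bopt n m p P D T M H K ->
  exists Pi : nat -> nat -> C,
  [/\ forall i i', Pi i i' != 0 -> P i && P i',
      forall (i : 'I_n) (c : 'I_m), P i -> D c ->
        \sum_(j < p | T j) H i j * K j c = \sum_(i' < n) Pi i i' * M i' c &
      forall v : nat -> C,
        \sum_(i < n | P i) sq (\sum_(i' < n) Pi i i' * v i') <=
        \sum_(i < n | P i) sq (v i)].
Proof.
move=> TP opt; have [Q [Rm [_ Qo HQ]]] := qr_exists H TP.
pose Pi i i' : C := if P i && P i' then \sum_(j < p | T j) Q i j * conjc (Q i' j) else 0.
pose y (v : nat -> C) (j : 'I_p) := \sum_(i' < n | P i') conjc (Q i' j) * v i'.
have PiE (v : nat -> C) (i : 'I_n) : P i ->
    \sum_(i' < n) Pi i i' * v i' = \sum_(j < p | T j) Q i j * y v j.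
  move=> Pi'; under [RHS]eq_bigr do rewrite mulr_sumr.
  rewrite exchange_big [RHS]big_mkcond /=; apply: eq_bigr => i' _.
  rewrite /Pi Pi' /=; case: ifP => _; last by rewrite mul0r.
  by rewrite mulr_suml; apply: eq_bigr => j _; rewrite mulrA.
exists Pi; split.
- by move=> i i'; rewrite /Pi; case: ifP => //; rewrite eqxx.
- move=> i c Pi' Dc; rewrite (PiE (fun i' => M i' c)) //.
  pose K1 (j : 'I_p) (c : 'I_m) := \sum_(k < p | T k) Rm j k * K k c.
  have HK (i1 : 'I_n) (c1 : 'I_m) : P i1 ->
      \sum_(j < p | T j) H i1 j * K j c1 = \sum_(j < p | T j) Q i1 j * K1 j c1.
    move=> Pi1; under eq_bigr => j Tj do rewrite HQ // mulr_suml.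
    rewrite exchange_big; apply: eq_bigr => k _; rewrite mulr_sumr.
    by apply: eq_bigr => j _; rewrite mulrA.
  pose M' c1 i1 := M i1 c1.
  pose Ko : 'M[C]_(p, m) := \matrix_(j, c) y (M' c) j.
  have := opt Q (ent (MX Ko)).
  rewrite /berr exchange_big /= [leRHS]exchange_big /=.
  have e1 (c1 : 'I_m) : \sum_(i < n | P i) sq (M i c1 - \sum_(j < p | T j) H i j * K j c1) =
      \sum_(i < n | P i) sq (M i c1) - \sum_(j < p | T j) sq (y (M' c1) j)
      + \sum_(j < p | T j) sq (y (M' c1) j - K1 j c1).
    rewrite -(pythagoras Qo (fun i : 'I_n => M i c1) (fun j => K1 j c1)).
    by apply: eq_bigr => i1 Pi1; rewrite HK.
  have e2 (c1 : 'I_m) : \sum_(i < n | P i) sq (M i c1 - \sum_(j < p | T j) Q i j * ent (MX Ko) j c1) =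
      \sum_(i < n | P i) sq (M i c1) - \sum_(j < p | T j) sq (y (M' c1) j).
    have := pythagoras Qo (fun i : 'I_n => M i c1) (fun j => y (M' c1) j).
    rewrite [X in _ + X]big1 ?addr0 => [<-|j _]; last by rewrite subrr sq0.
    apply: eq_bigr => i1 _; congr (cnorm (_ - _) ^+ 2); apply: eq_bigr => j _.
    by rewrite ent_ord mxE.
  rewrite (eq_bigr _ (fun c1 _ => e1 c1)) [leRHS](eq_bigr _ (fun c1 _ => e2 c1)).
  rewrite big_split /= gerDl exchange_big /= pair_big /= => le0.
  rewrite HK //; apply: eq_bigr => j Tj; congr (_ * _).
  have /= := sum_sq_eq0 le0 (i := (j, c)).
  by rewrite Tj Dc => /(_ isT)/eqP; rewrite subr_eq0 => /eqP.
- move=> v; rewrite (eq_bigr _ (fun i Pi' => congr1 (fun z => sq z) (PiE v i Pi'))).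
  by rewrite (isometry_sum Qo); apply: (bessel Qo (fun i : 'I_n => v i)).
Qed.

End BlockApprox.

(** * Supports and index classes *)

Local Open Scope nat_scope.

(* Interface [u] sits between the factors [u] and [u+1]: [N u] is the dimension
   there, [al u = a_{u+1}] and [de u = d_u], extended by [de 0 = b_1 d_1] and
   [al L = a_L c_L] at the two ends. *)
Record ifaces (L : nat) (N al de : nat -> nat) : Prop := Ifaces {
  N_gt0 : forall u, (u <= L)%N -> (0 < N u)%N;
  al_de_dvd : forall u, (u <= L)%N -> (al u * de u %| N u)%N;
  al_dvd : forall u v, (u <= v <= L)%N -> (al u %| al v)%N;
  de_dvd : forall u v, (u <= v <= L)%N -> (de v %| de u)%N;
  al_width : forall u v, (u <= v <= L)%N -> (N v %/ al v <= N u %/ al u)%N;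
  de_width : forall u v, (u <= v <= L)%N -> (N u %/ de u <= N v %/ de v)%N }.

(** The elements are exactly [a * w + x * d + b] with [x < w / d]. *)
Lemma card_divmod (n w d a b : nat) : (0 < w)%N -> (d %| w)%N -> (b < d)%N -> (a.+1 * w <= n)%N ->
  #|[pred i : 'I_n | (i %/ w == a) && (i %% d == b)]| = (w %/ d)%N.
Proof.
move=> w0 /dvdnP[q wE]; rewrite {w}wE in w0 * => bd le; have d0 : (0 < d)%N by apply: leq_ltn_trans bd.
rewrite mulnK //; have q0 : 0 < q by move: w0; rewrite muln_gt0 => /andP[].
have lt (x : 'I_q) : (a * (q * d) + (x * d + b) < n)%N.
  apply: leq_trans le; rewrite mulSn addnC ltn_add2r.
  by have := ltn_ord x; nia.
rewrite -[RHS]card_ord -(card_imset _ (f := fun x => Ordinal (lt x))); last first.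
  move=> x y /(congr1 val) /= /addnI/addIn/eqP; rewrite eqn_pmul2r // => /eqP.
  exact: val_inj.
apply: eq_card => i; rewrite !inE; apply/andP/imsetP => [[/eqP ea /eqP eb]|[x _ ->]] /=.
  have iE : nat_of_ord i = (a * (q * d) + ((i %% (q * d)) %/ d * d + b))%N.
    rewrite {1}(divn_eq i (q * d)) ea; congr (_ + _)%N.
    by rewrite {1}(divn_eq (i %% (q * d)) d) modn_dvdm ?dvdn_mull // eb.
  have xq : ((i %% (q * d)) %/ d < q)%N.
    by rewrite ltn_divLR // ltn_mod muln_gt0 q0.
  by exists (Ordinal xq) => //; apply: val_inj; rewrite /= -iE.
rewrite mulnA addnA -mulnDl modnMDl modn_small // eqxx; split=> //.
rewrite mulnDl -addnA -mulnA divnMDl ?muln_gt0 ?q0 // divn_small ?addn0 //.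
by have := ltn_ord x; nia.
Qed.

Section Interfaces.
Variables (L : nat) (N al de : nat -> nat).
Hypothesis IF : ifaces L N al de.

(** Interface [v] is cut into [al u] intervals of equal length; this is the number of the interval
    containing [i], that is, its coordinate in the factor [I_a] of a pattern starting at [u]. *)
Definition lev u v i := (i %/ (N v %/ al u))%N.
(** For [u < t] this is the support of the product pattern between the interfaces [u] and [t]. The
    bounds make supported functions vanish outside the matrix. *)
Definition bsup u t i j :=
  [&& i < N u, j < N t, lev u u i == lev u t j & i %% de t == j %% de t]%N.
(** The classes [P] of the partition at cut [s]. Neither end of the interval that is split occurs in
    the formula. *)
Definition cl s k k' :=
  [&& k < N s, k' < N s, lev s s k == lev s s k' & k %% de s == k' %% de s]%N.
(** The least index with level [a] and residue [b], used as canonical element of its class. *)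
Definition mk s a b := (a * (N s %/ al s) + b)%N.

Lemma al_dvdN u v : (u <= v <= L)%N -> (al u %| N v)%N.
Proof.
move=> uv; apply: dvdn_trans (al_dvd IF uv) _; case/andP: uv => _ vL.
exact: dvdn_trans (dvdn_mulr _ _) (al_de_dvd IF vL).
Qed.

Lemma al_gt0 u : (u <= L)%N -> (0 < al u)%N.
Proof.
move=> uL; have := al_dvdN (u := u) (v := u); rewrite leqnn uL => /(_ isT).
by apply: dvdn_gt0; apply: N_gt0 IF _ _.
Qed.

Lemma de_gt0 u : (u <= L)%N -> (0 < de u)%N.
Proof.
move=> uL; apply: (dvdn_gt0 (N_gt0 IF uL)).
exact: dvdn_trans (dvdn_mull _ _) (al_de_dvd IF uL).
Qed.

Lemma width_gt0 u v : (u <= v <= L)%N -> (0 < N v %/ al u)%N.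
Proof.
move=> /[dup] uv /andP[uv' vL].
rewrite divn_gt0; last by rewrite al_gt0 // (leq_trans uv').
by apply: dvdn_leq; [apply: (N_gt0 IF)|apply: al_dvdN].
Qed.

Lemma width_split u u' v : (u <= u')%N -> (u' <= v <= L)%N ->
  (N v %/ al u = N v %/ al u' * (al u' %/ al u))%N.
Proof.
move=> uu' /andP[u'v vL].
have d1 : (al u %| al u')%N by apply: (al_dvd IF); rewrite uu' (leq_trans u'v).
have d2 : (al u' %| N v)%N by apply: al_dvdN; rewrite u'v.
move: (divnK d2) (divnK d1); set X := N v %/ al u'; set Y := al u' %/ al u => e1 e2.
rewrite -e1 -e2 mulnA mulnK //.
by rewrite al_gt0 // (leq_trans uu') // (leq_trans u'v).
Qed.

Lemma lev_coarse u u' v i : (u <= u')%N -> (u' <= v <= L)%N ->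
  lev u v i = (lev u' v i %/ (al u' %/ al u))%N.
Proof. by move=> uu' u'v; rewrite /lev (width_split uu') // divnMA. Qed.

Lemma lev_eqW u u' v v' i j : (u <= u')%N -> (u' <= v <= L)%N -> (u' <= v' <= L)%N ->
  lev u' v i = lev u' v' j -> lev u v i = lev u v' j.
Proof. by move=> uu' h h' e; rewrite !(lev_coarse _ uu') // e. Qed.

Lemma mod_eqW s s' i j : (s <= s' <= L)%N -> (i = j %[mod de s] -> i = j %[mod de s'])%N.
Proof.
move=> ss' e; have d := de_dvd IF ss'.
by rewrite -(modn_dvdm i d) e modn_dvdm.
Qed.

Lemma de_width_dvd u v s : (u <= v <= L)%N -> (v <= s <= L)%N -> (de s %| N v %/ al u)%N.
Proof.
move=> /andP[uv vL] /andP[vs sL].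
have dv : (de v %| N v %/ al v)%N.
  have alv := al_gt0 vL; have := al_de_dvd IF vL.
  by rewrite dvdn_divRL ?al_dvdN ?leqnn // mulnC.
apply: dvdn_trans (de_dvd IF (_ : v <= s <= L)%N) _; first by rewrite vs.
by apply: dvdn_trans dv _; rewrite (width_split uv) ?leqnn ?vL // dvdn_mulr.
Qed.

Lemma lev_lt u v i : (u <= v <= L)%N -> (i < N v)%N -> (lev u v i < al u)%N.
Proof.
move=> uv iN; rewrite /lev ltn_divLR ?width_gt0 // mulnC divnK //.
exact: al_dvdN.
Qed.

(** Level and residue can be prescribed independently, since [de s] divides the length of a level
    interval. *)
Lemma mk_gen u v s a b : (u <= v <= L)%N -> (v <= s <= L)%N ->
  (a < al u)%N -> (b < de s)%N ->
  let k := (a * (N v %/ al u) + b)%N in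
  [/\ (k < N v)%N, lev u v k = a & (k %% de s = b)%N].
Proof.
move=> uv vs aa bd /=.
have dd := de_width_dvd uv vs; have w0 := width_gt0 uv.
have bw : (b < N v %/ al u)%N by apply: leq_trans bd (dvdn_leq w0 dd).
split.
- rewrite -{2}(divnK (al_dvdN uv)) mulnC; nia.
- by rewrite /lev divnMDl // divn_small // addn0.
- by rewrite -modnDml (eqP (dvdn_mull _ dd)) add0n modn_small.
Qed.

(** Equal levels at [s] remain equal at the coarser [u], and equal residues at [s] remain equal at
    the coarser [t]. *)
Lemma bsup_mono u s t r k c : (u <= s)%N -> (s <= t <= L)%N ->
  bsup u s r k -> bsup s t k c -> bsup u t r c.
Proof.
move=> us st /and4P[rN kN /eqP l1 /eqP m1] /and4P[_ cN /eqP l2 /eqP m2].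
case/andP: (st) => st' tL; have sL := leq_trans st' tL.
apply/and4P; split=> //; apply/eqP.
  by rewrite l1; apply: (lev_eqW us) => //; rewrite leqnn.
by rewrite -m2; apply: mod_eqW m1; rewrite st'.
Qed.

Lemma bsup_clr u s r k k' : (u <= s <= L)%N -> cl s k k' -> bsup u s r k = bsup u s r k'.
Proof.
move=> /andP[us sL] /and4P[kN k'N /eqP l /eqP m]; rewrite /bsup kN k'N m.
by rewrite (@lev_eqW u s s s k k') // leqnn.
Qed.

Lemma bsup_cll s t k k' c : (s <= t <= L)%N -> cl s k k' -> bsup s t k c = bsup s t k' c.
Proof.
move=> st /and4P[kN k'N /eqP l /eqP m]; rewrite /bsup kN k'N l.
by rewrite (mod_eqW st m).
Qed.

(** The row fixes the residue and the column fixes the level, so blocks of distinct classes are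
    disjoint. *)
Lemma bsup_cl u s t r k k' c : bsup u s r k -> bsup s t k c -> bsup u s r k' -> bsup s t k' c -> cl s k k'.
Proof.
move=> /and4P[_ kN _ /eqP m] /and4P[_ _ /eqP l _] /and4P[_ k'N _ /eqP m'] /and4P[_ _ /eqP l' _].
by rewrite /cl kN k'N l l' -m -m' !eqxx.
Qed.

Lemma cl_refl s k : (k < N s)%N -> cl s k k.
Proof. by move=> kN; rewrite /cl kN !eqxx. Qed.

Lemma cl_sym s k k' : cl s k k' = cl s k' k.
Proof. by rewrite /cl andbA [(k < _) && _]andbC -andbA ![_ == lev s s k']eq_sym
  ![_ == (k' %% _)%N]eq_sym. Qed.

Lemma cl_trans s k1 k2 k3 : cl s k1 k2 -> cl s k2 k3 -> cl s k1 k3.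
Proof. by move=> /and4P[a b /eqP c /eqP d] /and4P[a' b' c' d']; rewrite /cl a b' c d c' d'. Qed.

(* The canonical element of the class of [s] whose block contains [(r, c)]. *)
Definition rep s t r c := mk s (lev s t c) (r %% de s).

Lemma rep_lt s t r c : (s <= t <= L)%N -> (c < N t)%N -> (rep s t r c < N s)%N.
Proof.
move=> /andP[st tL] cN; have sL := leq_trans st tL.
have [] // := @mk_gen s s s (lev s t c) (r %% de s); rewrite ?leqnn //.
  by rewrite lev_lt ?st.
by rewrite ltn_mod de_gt0.
Qed.

Lemma repP u s t r c : (u <= s)%N -> (s <= t <= L)%N -> bsup u t r c ->
  bsup u s r (rep s t r c) /\ bsup s t (rep s t r c) c.
Proof.
move=> us st /and4P[rN cN /eqP l /eqP m]; case/andP: (st) => st' tL.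
have sL := leq_trans st' tL.
have [] := @mk_gen s s s (lev s t c) (r %% de s); rewrite ?leqnn //.
- by rewrite lev_lt ?st.
- by rewrite ltn_mod de_gt0.
rewrite -/(mk s _ _) -/(rep s t r c) => kN kl km; split; apply/and4P; split=> //.
- by apply/eqP; rewrite l; apply: (lev_eqW us) => //; rewrite leqnn.
- by rewrite km.
- by rewrite kl.
- by rewrite -m; apply/eqP/(mod_eqW st); rewrite km.
Qed.

Lemma rep_uniq u s t r k c : bsup u s r k -> bsup s t k c ->
  rep s t r c = mk s (lev s s k) (k %% de s).
Proof. by move=> /and4P[_ _ _ /eqP m] /and4P[_ _ /eqP l _]; rewrite /rep m -l. Qed.

Lemma bsup_ex_right s t k : (s <= t <= L)%N -> (k < N s)%N -> exists c, bsup s t k c.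
Proof.
move=> /[dup] st /andP[st' tL] kN; have sL := leq_trans st' tL.
have [] := @mk_gen s t t (lev s s k) (k %% de t); rewrite ?leqnn ?st' ?tL //.
- by rewrite lev_lt ?leqnn.
- by rewrite ltn_mod de_gt0.
move=> cN cl' cm; exists (lev s s k * (N t %/ al s) + k %% de t)%N.
by rewrite /bsup kN cN cl' cm !eqxx.
Qed.

Lemma bsup_ex_left u s k : (u <= s <= L)%N -> (k < N s)%N -> exists r, bsup u s r k.
Proof.
move=> /[dup] us /andP[us' sL] kN; have uL := leq_trans us' sL.
have [] := @mk_gen u u s (lev u s k) (k %% de s); rewrite ?leqnn ?us' ?sL //.
- by rewrite lev_lt ?us'.
- by rewrite ltn_mod de_gt0.
move=> cN cl' cm; exists (lev u s k * (N u %/ al u) + k %% de s)%N.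
by rewrite /bsup kN cN cl' cm !eqxx.
Qed.

Lemma level_le u v a : (u <= v <= L)%N -> (a < al u)%N -> (a.+1 * (N v %/ al u) <= N v)%N.
Proof.
move=> uv aa; rewrite -{2}(divnK (al_dvdN uv)) mulnC leq_mul2l aa orbT //.
Qed.

Lemma card_cl s k : (s <= L)%N -> (k < N s)%N ->
  #|[pred k' : 'I_(N s) | cl s k k']| = (N s %/ al s %/ de s)%N.
Proof.
move=> sL kN; rewrite -(@card_divmod (N s) _ _ (lev s s k) (k %% de s)).
- by apply: eq_card => k'; rewrite !inE /cl kN ltn_ord /= /lev
  ![_ == (k' %/ _)%N]eq_sym ![_ == (k' %% _)%N]eq_sym.
- by rewrite width_gt0 ?leqnn.
- by apply: de_width_dvd; rewrite leqnn.
- by rewrite ltn_mod de_gt0.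
- by apply: level_le; rewrite ?lev_lt ?leqnn.
Qed.

Lemma card_bsup_left u s k : (u <= s <= L)%N -> (k < N s)%N ->
  #|[pred r : 'I_(N u) | bsup u s r k]| = (N u %/ al u %/ de s)%N.
Proof.
move=> /[dup] us /andP[us' sL] kN; have uL := leq_trans us' sL.
rewrite -(@card_divmod (N u) _ _ (lev u s k) (k %% de s)).
- by apply: eq_card => k'; rewrite !inE /bsup kN ltn_ord /=.
- by rewrite width_gt0 ?leqnn.
- by apply: de_width_dvd; rewrite ?leqnn ?us'.
- by rewrite ltn_mod de_gt0.
- by apply: level_le; rewrite ?lev_lt ?leqnn ?us'.
Qed.

Lemma card_bsup_right s t k : (s <= t <= L)%N -> (k < N s)%N ->
  #|[pred c : 'I_(N t) | bsup s t k c]| = (N t %/ al s %/ de t)%N.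
Proof.
move=> /[dup] st /andP[st' tL] kN; have sL := leq_trans st' tL.
rewrite -(@card_divmod (N t) _ _ (lev s s k) (k %% de t)).
- by apply: eq_card => k'; rewrite !inE /bsup kN ltn_ord /= ![_ == lev s t k']eq_sym
   ![_ == (k' %% _)%N]eq_sym.
- by rewrite width_gt0 ?leqnn.
- by apply: de_width_dvd; rewrite ?leqnn ?st' ?tL.
- by rewrite ltn_mod de_gt0.
- by apply: level_le; rewrite ?lev_lt ?leqnn ?st'.
Qed.

(** Both sizes are interval lengths divided by [de s], and [al_width] compares these lengths. This
    gives the room needed for QR on columns. *)
Lemma card_cl_left u s k : (u <= s <= L)%N -> (k < N s)%N ->
  (#|[pred k' : 'I_(N s) | cl s k k']| <= #|[pred r : 'I_(N u) | bsup u s r k]|)%N.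
Proof.
move=> us kN; case/andP: (us) => _ sL.
by rewrite card_cl ?card_bsup_left // leq_div2r // (al_width IF).
Qed.

Lemma card_cl_right s t k : (s <= t <= L)%N -> (k < N s)%N ->
  (#|[pred k' : 'I_(N s) | cl s k k']| <= #|[pred c : 'I_(N t) | bsup s t k c]|)%N.
Proof.
move=> st kN; have sL : (s <= L)%N by case/andP: (st); apply: leq_trans.
(* Exchanging the two divisions puts both sizes over [al s], where [de_width] compares them. *)
rewrite card_cl ?card_bsup_right // -!divnMA ![(al s * _)%N]mulnC !divnMA.
by rewrite leq_div2r // (de_width IF).
Qed.

Lemma bsup_refl u k : (k < N u)%N -> bsup u u k k.
Proof. by move=> kN; rewrite /bsup kN !eqxx. Qed.

End Interfaces.

Section FunctionSupport.
Variables (R : realType) (N al de : nat -> nat).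

Definition fsupp u t (f : nat -> nat -> R[i]) :=
  forall i j, f i j != 0%R -> bsup N al de u t i j.

End FunctionSupport.

Lemma rel_steps (T : Type) (r : T -> T -> Prop) (f : nat -> T) (L : nat) :
  (forall x, r x x) -> (forall x y z, r x y -> r y z -> r x z) ->
  (forall u, u < L -> r (f u) (f u.+1)) -> forall u v, u <= v <= L -> r (f u) (f v).
Proof.
move=> rr rt step u v /andP[uv]; elim: v uv => [|v IH].
  by rewrite leqn0 => /eqP ->.
rewrite leq_eqVlt => /predU1P[-> //|]; rewrite ltnS => uv vL.
exact: rt (IH uv (ltnW vL)) (step _ vL).
Qed.

(** * Interface data of a non-redundant chainable architecture *)

Section Architecture.
Variable beta : seq pattern.
Local Notation L := (size beta).
Local Notation p := (pat beta).

Definition Nv u := if u is 0 then prows (p 1) else pcols (p u).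
Definition alv u := if u < L then pa (p u.+1) else pa (p L) * pc (p L).
Definition dev u := if u is 0 then pb (p 1) * pd (p 1) else pd (p u).

Hypotheses (L_gt0 : 0 < L) (arch : is_arch beta) (chain : chainable_arch beta)
  (nred : ~ redundant_arch beta).

Lemma pat_gt0 l : 1 <= l <= L -> [/\ 0 < pa (p l), 0 < pb (p l), 0 < pc (p l) & 0 < pd (p l)].
Proof.
case: arch => /(all_nthP (Pat 1 1 1 1)) pos _ /andP[l0 lL].
have : l.-1 < L by rewrite prednK.
by move/pos => /and4P.
Qed.

Lemma NvE u : u < L -> Nv u = pa (p u.+1) * pb (p u.+1) * pd (p u.+1).
Proof.
case: u => [//|u] uL; rewrite /Nv /pcols; case: arch => _; apply.
by rewrite uL.
Qed.

(** [r] is the integer ratio of the chainability condition: the equations clear its two divisions,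
    and the bounds are the negation of redundancy. *)
Lemma ratioE l : 1 <= l < L -> exists r,
  [/\ pa (p l) * pc (p l) = r * pa (p l.+1), pb (p l.+1) * pd (p l.+1) = r * pd (p l),
      r < pb (p l) & r < pc (p l.+1)].
Proof.
move=> lL; have [d1 d2 e _ _] := chain lL.
exists (Defs.ratio (p l) (p l.+1)); rewrite {1}/Defs.ratio divnK // /Defs.ratio e divnK //; split=> //.
- rewrite ltnNge; apply/negP => le; apply: nred; exists l; split=> //.
  by rewrite /redundant_pair /Defs.ratio e geq_min le.
- rewrite ltnNge; apply/negP => le; apply: nred; exists l; split=> //.
  by rewrite /redundant_pair /Defs.ratio e geq_min le orbT.
Qed.

(** The monotonicity fields reduce to neighbouring interfaces. There the two width inequalities read
    [r * d_l <= b_l * d_l] and [r * a_(l+1) <= a_(l+1) * c_(l+1)]; at the ends they follow from the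
    conventions for [de 0] and [al L]. *)
Lemma ifaces_arch : ifaces L Nv alv dev.
Proof.
have lastL : 1 <= L <= L by rewrite L_gt0 leqnn.
have firstL : 1 <= 1 <= L by rewrite L_gt0.
have NL : Nv L = pa (p L) * pc (p L) * pd (p L) by rewrite /Nv /pcols; case: L L_gt0.
have deL : dev L = pd (p L) by rewrite /dev; case: L L_gt0.
have alL : alv L = pa (p L) * pc (p L) by rewrite /alv ltnn.
have wal u : u < L -> Nv u %/ alv u = pb (p u.+1) * pd (p u.+1).
  move=> uL; rewrite NvE // /alv uL -mulnA mulKn //.
  by have [] := @pat_gt0 u.+1.
have wde u : 0 < u <= L -> Nv u %/ dev u = pa (p u) * pc (p u).
  case: u => // u uL; rewrite /Nv /pcols /dev mulnK //.
  by have [] := @pat_gt0 u.+1.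
have wde0 : Nv 0 %/ dev 0 = pa (p 1).
  have [_ b0 _ d0] := pat_gt0 firstL.
  by rewrite /Nv /prows /dev -mulnA mulnK // muln_gt0 b0.
split.
- move=> u uL; case: u uL => [|u] uL; rewrite /Nv /prows /pcols.
    by have [a0 b0 _ d0] := pat_gt0 firstL; rewrite !muln_gt0 a0 b0.
  by have [a0 _ c0 d0] := @pat_gt0 u.+1 uL; rewrite !muln_gt0 a0 c0.
- move=> u; rewrite leq_eqVlt => /predU1P[->|uL]; first by rewrite alL deL NL.
  rewrite /alv uL; case: u uL => [|u] uL; rewrite /Nv /dev /prows /pcols.
    by rewrite mulnA.
  by rewrite dvdn_mul //; have [] := @chain u.+1 uL.
- apply: (rel_steps (r := fun x y => x %| y)) => [||u uL]; [exact: dvdnn|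
  by move=> x y z; apply: dvdn_trans|].
  rewrite /alv uL; case: ifP => [u1L|/negbT].
    by have [] := @chain u.+1 u1L.
  rewrite -leqNgt => Lu; have -> : L = u.+1 by apply/eqP; rewrite eqn_leq Lu uL.
  exact: dvdn_mulr.
- apply: (rel_steps (r := fun x y => y %| x)) => [||u uL].
  + exact: dvdnn.
  + by move=> x y z xy yz; apply: dvdn_trans yz xy.
  + case: u uL => [|u] uL; rewrite /dev; first exact: dvdn_mull.
    by have [] := @chain u.+1 uL.
- apply: (rel_steps (r := fun x y => y <= x) (f := fun u => Nv u %/ alv u)) => [||u uL].
  + exact: leqnn.
  + by move=> x y z xy yz; apply: leq_trans yz xy.
  + cbv beta; rewrite (wal u) //; have [u1L|] := boolP (u.+1 < L).
      rewrite wal //; have [r [_ -> rb _]] := @ratioE u.+1 u1L.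
      by rewrite leq_mul2r (ltnW rb) orbT.
    rewrite -leqNgt => Lu; have <- : L = u.+1 by apply/eqP; rewrite eqn_leq Lu uL.
    have [a0 b0 c0 d0] := pat_gt0 lastL.
    by rewrite NL alL mulKn ?muln_gt0 ?a0 // leq_pmull.
- apply: (rel_steps (r := fun x y => x <= y) (f := fun u => Nv u %/ dev u)) => [||u uL].
  + exact: leqnn.
  + by move=> x y z; apply: leq_trans.
  + cbv beta; case: u uL => [|u] uL.
      rewrite wde0 wde // leq_pmulr //; by have [] := pat_gt0 firstL.
    have h1 : 0 < u.+1 <= L by exact: ltnW.
    rewrite (wde _ h1) (wde u.+2) //; have [r [-> _ _ rc]] := @ratioE u.+1 uL.
    by rewrite mulnC leq_mul2l (ltnW rc) orbT.
Qed.

(** Induction on the right end: in [pat_mul] the data of the inner interfaces cancel, so only those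
    of [u] and [t] survive. *)
Lemma prodpatE u t : u < t <= L ->
  prodpat beta u.+1 t = Pat (alv u) (Nv u %/ alv u %/ dev t) (Nv t %/ alv u %/ dev t) (dev t).
Proof.
have IFA := ifaces_arch.
move=> /andP[]; elim: t => // t IH; rewrite ltnS => ut tL.
have uL := leq_ltn_trans ut tL.
have := ut; rewrite leq_eqVlt => /predU1P[e|lt].
  subst t; rewrite /prodpat subnn /=.
  have [a0 b0 c0 d0] := @pat_gt0 u.+1 tL.
  rewrite NvE // /alv uL /dev -mulnA mulKn // mulnK // /Nv /pcols -mulnA mulKn // mulnK //.
  by case: (p u.+1).
have -> : prodpat beta u.+1 t.+1 = pat_mul (prodpat beta u.+1 t) (p t.+1).
  rewrite /prodpat subSn // -[(t - u.+1).+1]addn1 iotaD foldl_cat /=.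
  by congr (pat_mul _ (p _)); lia.
rewrite IH ?(ltnW tL) // /pat_mul /=; congr Pat.
- rewrite divnK //; apply: (de_width_dvd IFA); rewrite ?leqnn ?(ltnW uL) //.
  by rewrite ltnW // ltnW.
- rewrite /Nv /pcols /dev; have [a0 b0 c0 d0] := @pat_gt0 t.+1 tL.
  by rewrite -divnMA [alv u * _]mulnC divnMA mulnK.
Qed.

Lemma prows_prodpat u t : u < t <= L -> prows (prodpat beta u.+1 t) = Nv u.
Proof.
have IFA := ifaces_arch; move=> utL; rewrite prodpatE // /prows /=.
case/andP: utL => ut tL; have uL := ltnW (leq_trans ut tL); have ut' := ltnW ut.
rewrite -mulnA divnK; last by apply: (de_width_dvd IFA); rewrite ?leqnn ?tL ?ut'.
by rewrite mulnC divnK //; apply: (al_dvdN IFA); rewrite leqnn.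
Qed.

Lemma pcols_prodpat u t : u < t <= L -> pcols (prodpat beta u.+1 t) = Nv t.
Proof.
have IFA := ifaces_arch; move=> utL; rewrite prodpatE // /pcols /=.
case/andP: utL => ut tL; have uL := ltnW (leq_trans ut tL); have ut' := ltnW ut.
rewrite -mulnA divnK; last by apply: (de_width_dvd IFA); rewrite ?leqnn ?tL ?ut'.
by rewrite mulnC divnK //; apply: (al_dvdN IFA); rewrite tL ut'.
Qed.

Local Notation SS := (bsup Nv alv dev).
Local Notation CL := (cl Nv alv dev).

Lemma supp_prodpat u t i j : u < t <= L -> i < Nv u -> j < Nv t ->
  supp (prodpat beta u.+1 t) i j = SS u t i j.
Proof.
have IFA := ifaces_arch; move=> utL iN jN; rewrite prodpatE // /supp /= /bsup iN jN /=.
case/andP: utL => ut tL; have uL := ltnW (leq_trans ut tL); have ut' := ltnW ut.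
by rewrite !divnK //; apply: (de_width_dvd IFA); rewrite ?leqnn ?tL ?ut'.
Qed.

Section Classes.
Variables u s t : nat.
Hypotheses (us : u < s) (st : s < t) (tL : t <= L).
Local Notation q1 := (prodpat beta u.+1 s).
Local Notation q2 := (prodpat beta s.+1 t).

Let usL : u < s <= L. Proof. by rewrite us ltnW // (leq_trans st). Qed.
Let stL : s < t <= L. Proof. by rewrite st. Qed.
Let usL' : u <= s <= L. Proof. by rewrite ltnW // ltnW // (leq_trans st). Qed.
Let stL' : s <= t <= L. Proof. by rewrite ltnW. Qed.

Lemma Uent_bsup k r c : k < Nv s -> Uent q1 q2 k r c = SS u s r k && SS s t k c.
Proof.
move=> kN; rewrite /Uent prows_prodpat // pcols_prodpat //.
case: (ltnP r (Nv u)) => [rN|rN]; last by rewrite /bsup [r < _]ltnNge rN.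
rewrite supp_prodpat //=; congr (_ && _).
case: (ltnP c (Nv t)) => [cN|cN]; last by rewrite /bsup [c < _]ltnNge cN /= andbF.
by rewrite supp_prodpat.
Qed.

(** The existential over columns disappears because every index [k] has some column in its
    support. *)
Lemma inRP_bsup k r : k < Nv s -> inRP q1 q2 k r = SS u s r k.
Proof.
move=> kN; apply/existsP/idP => [[c]|Sr]; first by rewrite Uent_bsup // => /andP[].
have [c Sc] := bsup_ex_right ifaces_arch stL' kN.
have cN : c < pcols q2 by rewrite pcols_prodpat //; case/and4P: Sc.
by exists (Ordinal cN); rewrite Uent_bsup // Sr.
Qed.

Lemma inCP_bsup k c : k < Nv s -> inCP q1 q2 k c = SS s t k c.
Proof.
move=> kN; apply/existsP/idP => [[r]|Sc]; first by rewrite Uent_bsup // => /andP[].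
have [r Sr] := bsup_ex_left ifaces_arch usL' kN.
have rN : r < prows q1 by rewrite prows_prodpat //; case/and4P: Sr.
by exists (Ordinal rN); rewrite Uent_bsup // Sr.
Qed.

(** The support of [U_k] is nonempty, and any of its points determines the residue and the level of
    [k]. *)
Lemma inP_cl k k' : k < Nv s -> inP q1 q2 k k' = CL s k k'.
Proof.
move=> kN; rewrite /inP pcols_prodpat //.
case: (ltnP k' (Nv s)) => [k'N|k'N]; last by rewrite /cl [k' < _]ltnNge k'N andbF.
apply/idP/idP => [/forallP/= h|kk'].
  have [c Sc] := bsup_ex_right ifaces_arch stL' kN.
  have [r Sr] := bsup_ex_left ifaces_arch usL' kN.
  have cN : c < pcols q2 by rewrite pcols_prodpat //; case/and4P: Sc.
  have rN : r < prows q1 by rewrite prows_prodpat //; case/and4P: Sr.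
  have /forallP/(_ (Ordinal cN)) := h (Ordinal rN).
  by rewrite !Uent_bsup //= Sr Sc => /eqP/esym/andP[Sr' Sc']; apply: bsup_cl Sr Sc Sr' Sc'.
apply/forallP => r; apply/forallP => c; rewrite !Uent_bsup //.
by rewrite (bsup_clr ifaces_arch r usL' kk') (bsup_cll ifaces_arch c stL' kk').
Qed.

End Classes.

Section Factors.
Variable R : realType.

Definition isfac u t (X : mxs R) :=
  [/\ nr X = Nv u, nc X = Nv t & fsupp Nv alv dev u t (ent X)].

Lemma ent_neq0 (X : mxs R) i j : ent X i j != 0%R -> i < nr X /\ j < nc X.
Proof.
rewrite /ent; case: insubP => [i' ? _|]; last by rewrite eqxx.
by case: insubP => [j' ? _|]; last by rewrite eqxx.
Qed.

Lemma ent_Ordinal (X : mxs R) (i : 'I_(nr X)) (j : 'I_(nc X)) : ent X i j = mxof X i j.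
Proof. by rewrite /ent !valK. Qed.

Lemma is_factorE u t (X : mxs R) : u < t <= L ->
  is_factor (prodpat beta u.+1 t) X <-> isfac u t X.
Proof.
move=> utL; rewrite /is_factor /isfac prows_prodpat // pcols_prodpat //.
split=> -[rX cX h]; split=> //.
  move=> i j nz; have [iN jN] := ent_neq0 nz.
  apply: contraNT nz => nS; have := h (Ordinal iN) (Ordinal jN).
  rewrite -ent_Ordinal /= => -> //; rewrite supp_prodpat // -?rX -?cX //.
move=> i j nS; have iN : i < Nv u by rewrite -rX ltn_ord.
have jN : j < Nv t by rewrite -cX ltn_ord.
rewrite -ent_Ordinal; apply/eqP; apply: contraNT nS => /h.
by rewrite supp_prodpat.
Qed.

Lemma block_supportedE u s t (X Y : mxs R) : u < s -> s < t -> t <= L ->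
  block_supported (prodpat beta u.+1 s) (prodpat beta s.+1 t) X Y <->
  isfac u s X /\ isfac s t Y.
Proof.
move=> us st tL; have sL := leq_trans (ltnW st) tL.
rewrite /block_supported !prows_prodpat ?us ?st // !pcols_prodpat ?us ?st //; split.
  move=> [[rX cX] [rY cY] hX hY]; split; split=> // i j nz.
    have [_ jN] := ent_neq0 nz; rewrite cX in jN.
    by rewrite -(inRP_bsup us st tL _ jN); apply: contraNT nz => /hX/eqP.
  have [iN _] := ent_neq0 nz; rewrite rY in iN.
  by rewrite -(inCP_bsup us st tL _ iN); apply: contraNT nz => /hY/eqP.
move=> [[rX cX hX] [rY cY hY]]; split; rewrite ?rX ?cX ?rY ?cY // => i j ni.
  apply/eqP; apply: contraNT ni => nz; have /and4P[_ jN _ _] := hX _ _ nz.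
  by rewrite (inRP_bsup us st tL) // hX.
apply/eqP; apply: contraNT ni => nz; have /and4P[iN _ _ _] := hY _ _ nz.
by rewrite (inCP_bsup us st tL) // hY.
Qed.

End Factors.
End Architecture.

(** * Block optimality *)

Local Open Scope ring_scope.

Section Blocks.
Variable R : realType.
Local Notation C := (R[i]).
Local Notation sq z := (cnorm z ^+ 2).
Variables (L : nat) (N al de : nat -> nat).
Hypothesis IF : ifaces L N al de.
Local Notation S := (bsup N al de).
Local Notation cl := (cl N al de).
Local Notation lev := (lev N al).
Local Notation fsupp := (@fsupp R N al de).
Implicit Types f g F G M X Y H K : nat -> nat -> C.

Definition fmul n f g i j : C := \sum_(k < n) f i k * g k j.

Lemma fmulA n m f g h : fmul n f (fmul m g h) =2 fmul m (fmul n f g) h.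
Proof.
move=> i j; rewrite /fmul; under eq_bigr do rewrite mulr_sumr.
rewrite exchange_big; apply: eq_bigr => k _; rewrite mulr_suml.
by apply: eq_bigr => l _; rewrite mulrA.
Qed.

Lemma sum_neq0 (I : finType) (P : pred I) (F : I -> C) :
  \sum_(i | P i) F i != 0 -> exists2 i, P i & F i != 0.
Proof.
move=> nz; case: (pickP (fun i => P i && (F i != 0))) => [i /andP[]|none].
  by exists i.
case/eqP: nz; apply: big1 => i Pi; have := none i; rewrite Pi /= => /negbT.
by rewrite negbK => /eqP.
Qed.

Lemma mul_neq0 (x y : C) : x * y != 0 -> x != 0 /\ y != 0.
Proof. by rewrite mulf_eq0 negb_or => /andP[]. Qed.

Lemma sum_restrict (I : finType) (P Q : pred I) (F : I -> C) :
  (forall i, P i -> F i != 0 -> Q i) -> (forall i, Q i -> P i) ->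
  \sum_(i | P i) F i = \sum_(i | Q i) F i.
Proof.
move=> PQ QP; rewrite big_mkcond [RHS]big_mkcond; apply: eq_bigr => i _.
case: ifP => Pi; case: ifP => Qi //; last by rewrite QP in Pi.
by apply/eqP; apply: contraFT Qi; apply: PQ.
Qed.

Lemma fsupp_fmul u s t f g : (u <= s)%N -> (s <= t <= L)%N ->
  fsupp u s f -> fsupp s t g -> fsupp u t (fmul (N s) f g).
Proof.
move=> us st hf hg i j /sum_neq0[k _ /mul_neq0[/hf h1 /hg h2]].
exact (bsup_mono IF us st h1 h2).
Qed.

(** The row and the column already single out one class, so the other inner indices contribute
    zero. *)
Lemma fmul_class u s t f g k r c : fsupp u s f -> fsupp s t g ->
  S u s r k -> S s t k c -> fmul (N s) f g r c = \sum_(k' < N s | cl s k k') f r k' * g k' c.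
Proof.
move=> hf hg Sr Sc; apply: sum_restrict => // k' _ /mul_neq0[/hf Sr' /hg Sc'].
exact: bsup_cl Sr Sc Sr' Sc'.
Qed.

(** Only columns of equal level are compared: the row set of a block at a later cut, seen at
    interface [u], has a single level. Dually, [roworth] compares rows of equal residue. *)
Definition colorth u F := forall i i', (i < N u)%N -> (i' < N u)%N -> lev u u i = lev u u i' ->
  \sum_(r < N 0) conjc (F r i) * F r i' = (i == i')%:R.

Definition roworth t G := forall j j', (j < N t)%N -> (j' < N t)%N -> (j = j' %[mod de t])%N ->
  \sum_(c < N L) conjc (G j c) * G j' c = (j == j')%:R.

Lemma sum_conj_mul (I J : finType) (F : I -> J -> C) (x y : J -> C) :
  \sum_r conjc (\sum_i F r i * x i) * (\sum_i F r i * y i) =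
  \sum_i \sum_i' conjc (x i) * y i' * \sum_r conjc (F r i) * F r i'.
Proof.
under eq_bigr do rewrite conjc_sum mulr_suml.
rewrite exchange_big; apply: eq_bigr => i _.
under eq_bigr do rewrite mulr_sumr.
rewrite exchange_big; apply: eq_bigr => i' _; rewrite mulr_sumr.
by apply: eq_bigr => r _; rewrite rmorphM /= mulrACA [RHS]mulrC.
Qed.

Lemma sum_delta (n : nat) (D : 'I_n -> 'I_n -> C) (x y : 'I_n -> C) :
  (forall i i', x i != 0 -> y i' != 0 -> D i i' = (i == i')%:R) ->
  \sum_i \sum_i' conjc (x i) * y i' * D i i' = \sum_i conjc (x i) * y i.
Proof.
move=> h; apply: eq_bigr => i _.
transitivity (\sum_i' conjc (x i) * y i' * (i == i')%:R).
  apply: eq_bigr => i' _; have [->|xi] := eqVneq (x i) 0; first by rewrite conjc0 !mul0r.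
  have [->|yi] := eqVneq (y i') 0; first by rewrite mulr0 !mul0r.
  by rewrite h.
rewrite (bigD1 i) //= eqxx mulr1 big1 ?addr0 // => i' ni.
by rewrite eq_sym (negPf ni) mulr0.
Qed.

(** The columns of [X] involved have supports of one level, on which [F] is an isometry. Within a
    class the products are given by hypothesis; for distinct residues the supports of the columns of
    [X] are disjoint. *)
Lemma colorth_fmul u s F X : (u <= s <= L)%N ->
  colorth u F -> fsupp u s X ->
  (forall k k', cl s k k' ->
     \sum_(i < N u | S u s i k) conjc (X i k) * X i k' = (k == k')%:R) ->
  colorth s (fmul (N u) F X).
Proof.
move=> us oF sX oX k k' kN k'N lk; rewrite /fmul.
rewrite (sum_conj_mul (fun (r : 'I_(N 0)) (i : 'I_(N u)) => F r i)
  (fun i : 'I_(N u) => X i k) (fun i : 'I_(N u) => X i k')).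
case/andP: (us) => us' sL.
rewrite sum_delta => [|i i' /sX /and4P[_ _ /eqP l _] /sX /and4P[_ _ /eqP l' _]].
  case: (eqVneq (k %% de s)%N (k' %% de s)%N) => [mk|nm].
    rewrite -oX; last by rewrite /cl kN k'N lk mk !eqxx.
    apply: sum_restrict => // i _ /mul_neq0[]; rewrite conjc_eq0.
    by move/sX.
  have /negPf -> : k != k' by apply: contra nm => /eqP ->.
  rewrite big1 // => i _; apply/eqP; apply: contraNT nm => /mul_neq0[].
  by rewrite conjc_eq0 => /sX/and4P[_ _ _ /eqP <-] /sX/and4P[_ _ _ /eqP <-].
rewrite oF // l l'; apply: (lev_eqW IF us') => //; by rewrite leqnn.
Qed.

Lemma roworth_fmul s t Y G : (s <= t <= L)%N ->
  roworth t G -> fsupp s t Y ->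
  (forall k k', cl s k k' ->
     \sum_(j < N t | S s t k j) conjc (Y k j) * Y k' j = (k == k')%:R) ->
  roworth s (fmul (N t) Y G).
Proof.
move=> st oG sY oY k k' kN k'N mk; rewrite /fmul.
(* Commuting the factors presents [G] as a map acting on the rows of [Y], so that [sum_conj_mul]
   applies as on the column side. *)
under eq_bigr do (under eq_bigr do rewrite mulrC);
  under eq_bigr do (under [X in _ * X]eq_bigr do rewrite mulrC).
rewrite (sum_conj_mul (fun (c : 'I_(N L)) (j : 'I_(N t)) => G j c)
  (fun j : 'I_(N t) => Y k j) (fun j : 'I_(N t) => Y k' j)).
rewrite sum_delta => [|j j' /sY /and4P[_ _ _ /eqP m] /sY /and4P[_ _ _ /eqP m']].
  case: (eqVneq (lev s s k) (lev s s k')) => [lk|nl].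
    rewrite -oY; last by rewrite /cl kN k'N lk mk !eqxx.
    apply: sum_restrict => // j _ /mul_neq0[]; rewrite conjc_eq0.
    by move/sY.
  have /negPf -> : k != k' by apply: contra nl => /eqP ->.
  rewrite big1 // => j _; apply/eqP; apply: contraNT nl => /mul_neq0[].
  by rewrite conjc_eq0 => /sY/and4P[_ _ /eqP -> _] /sY/and4P[_ _ /eqP -> _].
by rewrite oG // -m -m'; apply: (mod_eqW IF st).
Qed.

(** A path from [r] to [c] through [M] inside the block of [k] can meet [M] only in its own block of
    [k]: the residue of [i] comes from [r], the level of [j] from [c], and the support of [M]
    transmits both. *)
Lemma bsup_mid u s t r i j c k : (u <= s)%N -> (s <= t <= L)%N ->
  S 0 u r i -> S u t i j -> S t L j c -> S 0 s r k -> S s L k c ->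
  S u s i k /\ S s t k j.
Proof.
move=> us st; case/andP: (st) => st' tL; have sL := leq_trans st' tL.
move=> /and4P[_ iN _ /eqP m1] /and4P[_ jN /eqP l2 /eqP m2] /and4P[_ cN /eqP l3 _].
move=> /and4P[_ kN _ /eqP m4] /and4P[_ _ /eqP l5 _].
have lj : lev s t j = lev s s k.
  by rewrite l5; apply: (lev_eqW IF st') l3; rewrite ?tL ?leqnn.
have mi : (i = k %[mod de s])%N.
  by rewrite -m4; apply/esym; apply: (mod_eqW IF _ m1); rewrite us.
have mj : (k = j %[mod de t])%N by rewrite -m2; apply/esym/(mod_eqW IF st).
split; apply/and4P; split=> //; apply/eqP => //.
by rewrite l2; apply: (lev_eqW IF us) lj; rewrite ?st ?leqnn.
Qed.

(* Orthonormality of the outer factors reduces each block problem for the whole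
   product to the block problem for its middle factor. *)
Lemma bopt_sandwich u s t F M G X Y k : (u <= s)%N -> (s <= t <= L)%N -> (k < N s)%N ->
  fsupp 0 u F -> colorth u F -> fsupp u t M -> fsupp t L G -> roworth t G ->
  fsupp u s X -> fsupp s t Y ->
  bopt (N u) (N t) (N s) (S u s ^~ k) (S s t k) (cl s k) M X Y ->
  bopt (N 0) (N L) (N s) (S 0 s ^~ k) (S s L k) (cl s k)
    (fmul (N u) F (fmul (N t) M G)) (fmul (N u) F X) (fmul (N t) Y G).
Proof.
move=> us st kN sF oF sM sG oG sX sY opt H K.
case/andP: (st) => st' tL; have sL := leq_trans st' tL.
have usL : (u <= s <= L)%N by rewrite us.
have oF' (i i' : 'I_(N u)) : S u s i k -> S u s i' k ->
    \sum_(r < N 0 | S 0 s r k) conjc (F r i) * F r i' = (i == i')%:R.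
  move=> Si Si'; rewrite -val_eqE /= -oF //; last first.
    by case/and4P: Si => _ _ /eqP -> _; case/and4P: Si' => _ _ /eqP -> _.
  apply: esym; apply: sum_restrict => // r _ /mul_neq0[]; rewrite conjc_eq0 => /sF Sr _.
  exact: (bsup_mono IF (leq0n u) usL Sr Si).
have oG' (j j' : 'I_(N t)) : S s t k j -> S s t k j' ->
    \sum_(c < N L | S s L k c) conjc (G j c) * G j' c = (j == j')%:R.
  move=> Sj Sj'; rewrite -val_eqE /= -oG //; last first.
    by case/and4P: Sj => _ _ _ /eqP <-; case/and4P: Sj' => _ _ _ /eqP <-.
  apply: esym; apply: sum_restrict => // c _ /mul_neq0[]; rewrite conjc_eq0 => /sG Sr _.
  by apply: (bsup_mono IF st' _ Sj Sr); rewrite tL leqnn.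
(* The block of the whole product is the isometric image of the block [D] of the middle factor. *)
pose mid (D : 'I_(N u) -> 'I_(N t) -> C) r c : C :=
  \sum_(i < N u | S u s i k) F r i * \sum_(j < N t | S s t k j) G j c * D i j.
have BE (r : 'I_(N 0)) (c : 'I_(N L)) : S 0 s r k -> S s L k c ->
    fmul (N u) F (fmul (N t) M G) r c = mid (fun i j => M i j) r c.
  move=> Sr Sc; rewrite /mid.
  transitivity (\sum_(i < N u | S u s i k) F r i * fmul (N t) M G i c).
    apply: sum_restrict => // i _ /mul_neq0[/sF Fri /sum_neq0[j _ /mul_neq0[/sM Mij /sG Gjc]]].
    by have [] := bsup_mid us st Fri Mij Gjc Sr Sc.
  apply: eq_bigr => i Si; have [->|/sF Fri] := eqVneq (F r i) 0; first by rewrite !mul0r.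
  congr (_ * _); under [RHS]eq_bigr do rewrite mulrC.
  apply: sum_restrict => // j _ /mul_neq0[/sM Mij /sG Gjc].
  by have [] := bsup_mid us st Fri Mij Gjc Sr Sc.
have B'E (r : 'I_(N 0)) (c : 'I_(N L)) : S 0 s r k -> S s L k c ->
    \sum_(k' < N s | cl s k k') fmul (N u) F X r k' * fmul (N t) Y G k' c =
    mid (fun i j => \sum_(k' < N s | cl s k k') X i k' * Y k' j) r c.
  move=> Sr Sc; rewrite /mid.
  transitivity (\sum_(k' < N s | cl s k k')
      (\sum_(i < N u | S u s i k) F r i * X i k') *
      (\sum_(j < N t | S s t k j) Y k' j * G j c)).
    apply: eq_bigr => k' ck'; congr (_ * _).
      apply: sum_restrict => // i _ /mul_neq0[_ /sX].
      by rewrite (bsup_clr IF i usL ck').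
    apply: sum_restrict => // j _ /mul_neq0[/sY + _].
    by rewrite (bsup_cll IF j st ck').
  under eq_bigr do rewrite mulr_suml.
  rewrite exchange_big; apply: eq_bigr => i _.
  under eq_bigr do rewrite -mulrA mulr_sumr.
  rewrite -mulr_sumr exchange_big; congr (_ * _); apply: eq_bigr => j _.
  by rewrite mulr_sumr; apply: eq_bigr => k' _; rewrite mulrA [RHS]mulrC.
have midB D D' r c : mid D r c - mid D' r c = mid (fun i j => D i j - D' i j) r c.
  rewrite /mid -sumrB; apply: eq_bigr => i _; rewrite -mulrBr -sumrB.
  by congr (_ * _); apply: eq_bigr => j _; rewrite mulrBr.
pose D i j : C := M i j - \sum_(k' < N s | cl s k k') X i k' * Y k' j.
have -> : berr (N 0) (N L) (N s) (S 0 s ^~ k) (S s L k) (cl s k)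
    (fmul (N u) F (fmul (N t) M G)) (fmul (N u) F X) (fmul (N t) Y G) =
    berr (N u) (N t) (N s) (S u s ^~ k) (S s t k) (cl s k) M X Y.
  transitivity (\sum_(r < N 0 | S 0 s r k) \sum_(c < N L | S s L k c)
      sq (mid (fun i j => D i j) r c)).
    by apply: eq_bigr => r Sr; apply: eq_bigr => c Sc; rewrite BE // B'E // midB.
  rewrite exchange_big /mid /=.
  under eq_bigr do rewrite (isometry_sum oF').
  rewrite exchange_big; apply: eq_bigr => i Si.
  by rewrite (isometry_sum (Q := fun (c : 'I_(N L)) (j : 'I_(N t)) => G j c) oG').
(* A competitor for the large block is compressed by the adjoints of [F] and [G] to one for the
   middle block; two uses of Bessel's inequality show that its error does not grow. *)
pose H1 i k' : C := \sum_(r < N 0 | S 0 s r k) conjc (F r i) * H r k'.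
pose K1 k' j : C := \sum_(c < N L | S s L k c) conjc (G j c) * K k' c.
apply: le_trans (opt H1 K1) _.
pose E r c : C := fmul (N u) F (fmul (N t) M G) r c - \sum_(k' < N s | cl s k k') H r k' * K k' c.
apply: (@le_trans _ _ (\sum_(c < N L | S s L k c) \sum_(i < N u | S u s i k)
    sq (\sum_(r < N 0 | S 0 s r k) conjc (F r i) * E r c))); last first.
  rewrite /berr [leRHS]exchange_big; apply: ler_sum => c _.
  exact: (bessel oF' (fun r : 'I_(N 0) => E r c)).
rewrite exchange_big /berr; apply: ler_sum => i Si.
apply: le_trans (bessel (Q := fun (c : 'I_(N L)) (j : 'I_(N t)) => G j c) oG'
  (fun c : 'I_(N L) => \sum_(r < N 0 | S 0 s r k) conjc (F r i) * E r c)).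
rewrite le_eqVlt; apply/orP; left; apply/eqP; apply: eq_bigr => j Sj.
congr (cnorm _ ^+ 2).
have -> : M i j = \sum_(c < N L | S s L k c) conjc (G j c) *
    \sum_(r < N 0 | S 0 s r k) conjc (F r i) * mid (fun i j => M i j) r c.
  rewrite /mid; apply/esym.
  transitivity (\sum_(c < N L | S s L k c) conjc (G j c) *
      \sum_(i' < N u | S u s i' k) (i == i')%:R *
         (\sum_(j' < N t | S s t k j') G j' c * M i' j')).
    apply: eq_bigr => c Sc; congr (_ * _).
    under eq_bigr do rewrite mulr_sumr.
    rewrite exchange_big; apply: eq_bigr => i' Si'; rewrite -oF' // mulr_suml.
    by apply: eq_bigr => r _; rewrite mulrA.
  transitivity (\sum_(c < N L | S s L k c) conjc (G j c) *
         (\sum_(j' < N t | S s t k j') G j' c * M i j')).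
    apply: eq_bigr => c Sc; congr (_ * _); rewrite (bigD1 i) //= eqxx mul1r.
    by rewrite [X in _ + X]big1 ?addr0 // => i' /andP[_ ni]; rewrite eq_sym (negPf ni) mul0r.
  under eq_bigr do rewrite mulr_sumr.
  rewrite exchange_big (bigD1 j) //= [X in _ + X]big1 ?addr0.
    under eq_bigr do rewrite mulrA.
    by rewrite -mulr_suml oG' // eqxx mul1r.
  move=> j' /andP[Sj' nj]; under eq_bigr do rewrite mulrA.
  by rewrite -mulr_suml oG' // eq_sym (negPf nj) mul0r.
have -> : \sum_(k' < N s | cl s k k') H1 i k' * K1 k' j =
    \sum_(c < N L | S s L k c) conjc (G j c) *
    \sum_(r < N 0 | S 0 s r k) conjc (F r i) * \sum_(k' < N s | cl s k k') H r k' * K k' c.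
  rewrite /H1 /K1; under eq_bigr do rewrite mulr_sumr.
  rewrite exchange_big; apply: eq_bigr => c Sc.
  under [X in _ = _ * X]eq_bigr do rewrite mulr_sumr.
  rewrite exchange_big mulr_sumr; apply: eq_bigr => k' _.
  rewrite mulrCA mulr_suml; congr (_ * _).
  by apply: eq_bigr => r _; rewrite mulrA.
rewrite -sumrB; apply: eq_bigr => c Sc; rewrite -mulrBr -sumrB; congr (_ * _).
by apply: eq_bigr => r Sr; rewrite -mulrBr /E BE.
Qed.

End Blocks.

(** * Triangle inequality for the Frobenius norm *)

Section Minkowski.
Variable R : realType.
Local Notation sq z := (cnorm z ^+ 2).

Lemma cauchy_schwarz_sum (I : finType) (x y : I -> R) :
  \sum_i x i * y i <= Num.sqrt (\sum_i x i ^+ 2) * Num.sqrt (\sum_i y i ^+ 2).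
Proof.
have ge0 (z : I -> R) : 0 <= \sum_i z i ^+ 2 by apply: sumr_ge0 => i _; apply: sqr_ge0.
set a := Num.sqrt (\sum_i x i ^+ 2); set b := Num.sqrt (\sum_i y i ^+ 2).
have a2 : a ^+ 2 = \sum_i x i ^+ 2 by rewrite sqr_sqrtr.
have b2 : b ^+ 2 = \sum_i y i ^+ 2 by rewrite sqr_sqrtr.
have a0 : 0 <= a by apply: sqrtr_ge0.
have b0 : 0 <= b by apply: sqrtr_ge0.
have zero (z : I -> R) : \sum_i z i ^+ 2 = 0 -> forall i, z i = 0.
  move=> /eqP; rewrite psumr_eq0 => [/allP h i|i _]; last exact: sqr_ge0.
  by have := h i (mem_index_enum _); rewrite /= sqrf_eq0 => /eqP.
have [a_eq0|a_neq0] := eqVneq a 0.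
  rewrite a_eq0 mul0r big1 // => i _; rewrite (zero x) ?mul0r //.
  by rewrite -a2 a_eq0 expr0n.
have [b_eq0|b_neq0] := eqVneq b 0.
  rewrite b_eq0 mulr0 big1 // => i _; rewrite (zero y) ?mulr0 //.
  by rewrite -b2 b_eq0 expr0n.
have ab0 : 0 < a * b by rewrite mulr_gt0 // lt_def ?a_neq0 ?b_neq0.
(* Expanded, this nonnegative sum is [2 * (a * b) ^ 2] minus [2 * (a * b)] times the inner product,
   and [a * b > 0] can be cancelled. *)
have := ge0 (fun i => b * x i - a * y i).
have -> : \sum_i (b * x i - a * y i) ^+ 2 =
    b ^+ 2 * \sum_i x i ^+ 2 - 2 * (a * b) * \sum_i x i * y i + a ^+ 2 * \sum_i y i ^+ 2.
  rewrite !mulr_sumr -sumrB -big_split /=; apply: eq_bigr => i _; ring.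
rewrite -a2 -b2 => h; rewrite -subr_ge0 -(pmulr_rge0 _ ab0).
nra.
Qed.

Lemma minkowski_sum (I : finType) (f g : I -> R[i]) :
  Num.sqrt (\sum_i sq (f i + g i)) <=
  Num.sqrt (\sum_i sq (f i)) + Num.sqrt (\sum_i sq (g i)).
Proof.
have ge0 (z : I -> R[i]) : 0 <= \sum_i sq (z i).
  by apply: sumr_ge0 => i _; apply: sq_ge0.
rewrite -[leRHS]ger0_norm ?addr_ge0 ?sqrtr_ge0 // -sqrtr_sqr ler_wsqrtr //.
rewrite sqrrD !sqr_sqrtr //.
apply: (@le_trans _ _ (\sum_i (cnorm (f i) + cnorm (g i)) ^+ 2)).
  apply: ler_sum => i _; rewrite ler_sqr ?nnegrE ?addr_ge0 //; last first.
  - by rewrite /cnorm; case: (g i) => *; apply: sqrtr_ge0.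
  - by rewrite /cnorm; case: (f i) => *; apply: sqrtr_ge0.
  - by rewrite /cnorm; case: (_ + _) => *; apply: sqrtr_ge0.
  - exact: le_normcD.
under eq_bigr do rewrite sqrrD.
rewrite !big_split /=.
by rewrite lerD2r lerD2l mulr2n lerD // cauchy_schwarz_sum.
Qed.

End Minkowski.

(** * Blockwise optimality and contraction towards the other cuts *)

Section Contraction.
Variable R : realType.
Local Notation C := (R[i]).
Local Notation sq z := (cnorm z ^+ 2).
Variables (L : nat) (N al de : nat -> nat).
Hypothesis IF : ifaces L N al de.
Local Notation S := (bsup N al de).
Local Notation cl := (cl N al de).
Local Notation lev := (lev N al).
Local Notation rep := (rep N al de).
Local Notation fsupp := (@fsupp R N al de).
Implicit Types f g F G M X Y H K B : nat -> nat -> C.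

Definition fn2 f : R := \sum_(r < N 0) \sum_(c < N L) sq (f r c).
Definition fn f : R := Num.sqrt (fn2 f).

Lemma fn_triangle f g h :
  fn (fun r c => f r c - h r c) <=
  fn (fun r c => f r c - g r c) + fn (fun r c => g r c - h r c).
Proof.
rewrite /fn /fn2 !pair_big /=.
apply: le_trans (minkowski_sum _ _); rewrite le_eqVlt; apply/orP; left.
by apply/eqP; congr Num.sqrt; apply: eq_bigr => x _; rewrite addrA subrK.
Qed.

Definition isrep s k := (k == mk N al s (lev s s k) (k %% de s))%N.

(** The blocks of any one cut tile the global support, each counted once through its canonical
    representative. The remaining entries form a term on which no admissible product acts. *)
Lemma fn2_blocks s f : (s <= L)%N -> fn2 f =
  \sum_(x : 'I_(N 0) * 'I_(N L) | ~~ S 0 L x.1 x.2) sq (f x.1 x.2) +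
  \sum_(k < N s | isrep s k) \sum_(r < N 0 | S 0 s r k) \sum_(c < N L | S s L k c) sq (f r c).
Proof.
move=> sL; have sLL : (s <= L <= L)%N by rewrite sL leqnn.
rewrite /fn2 pair_big /= (bigID (fun x : 'I_(N 0) * 'I_(N L) => S 0 L x.1 x.2)) /= addrC.
congr (_ + _).
pose rp (x : 'I_(N 0) * 'I_(N L)) : 'I_(N s) := Ordinal (rep_lt IF x.1 sLL (ltn_ord x.2)).
rewrite (partition_big rp (fun k => isrep s k)) /=; last first.
  move=> [r c] /= Src; rewrite /isrep /=.
  have [h1 h2] := repP IF (leq0n s) sLL Src.
  by rewrite -(rep_uniq h1 h2).
apply: eq_bigr => k kr; rewrite pair_big_dep /=; apply: eq_bigl => -[r c] /=.
apply/andP/andP => [[Src /eqP e]|[Sr Sc]].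
  have [h1 h2] := repP IF (leq0n s) sLL Src.
  have -> : nat_of_ord k = rep s L r c by rewrite -e.
  by [].
split; first exact: (bsup_mono IF (leq0n s) sLL Sr Sc).
by apply/eqP/val_inj; rewrite /= (rep_uniq Sr Sc) -(eqP kr).
Qed.

Definition optimal s B X Y := forall k, (k < N s)%N ->
  bopt (N 0) (N L) (N s) (S 0 s ^~ k) (S s L k) (cl s k) B X Y.

Lemma fmul_off s X Y r c : (s <= L)%N -> fsupp 0 s X -> fsupp s L Y ->
  ~~ S 0 L r c -> fmul (N s) X Y r c = 0.
Proof.
move=> sL sX sY nS; apply/eqP; apply: contraNT nS.
by apply: (fsupp_fmul IF (leq0n s) _ sX sY); rewrite sL leqnn.
Qed.

(** The block problems are independent, and both products vanish off the global support. *)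
Lemma optimal_le s B X Y X1 Y1 : (s <= L)%N -> optimal s B X Y ->
  fsupp 0 s X -> fsupp s L Y -> fsupp 0 s X1 -> fsupp s L Y1 ->
  fn2 (fun r c => B r c - fmul (N s) X Y r c) <=
  fn2 (fun r c => B r c - fmul (N s) X1 Y1 r c).
Proof.
move=> sL opt sX sY sX1 sY1; rewrite !(fn2_blocks _ sL); apply: lerD.
  rewrite le_eqVlt; apply/orP; left; apply/eqP; apply: eq_bigr => -[r c] /= nS.
  by rewrite (fmul_off sL sX sY) // (fmul_off sL sX1 sY1).
apply: ler_sum => k _; have := opt k (ltn_ord k) X1 Y1; rewrite /berr.
congr (_ <= _); apply: eq_bigr => r Sr; apply: eq_bigr => c Sc.
  by rewrite (fmul_class sX sY Sr Sc).
by rewrite (fmul_class sX1 sY1 Sr Sc).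
Qed.

(* The optimal block approximations at [s] are blockwise left projections; these
   respect the coarser row blocks of any [s' > s]. *)
Lemma optimal_contract_left s s' B X Y X1 Y1 : (s <= s' <= L)%N -> optimal s B X Y ->
  fsupp 0 s X -> fsupp s L Y -> fsupp 0 s' X1 -> fsupp s' L Y1 ->
  exists2 X2, fsupp 0 s' X2 &
  fn2 (fun r c => fmul (N s) X Y r c - fmul (N s') X2 Y1 r c) <=
  fn2 (fun r c => B r c - fmul (N s') X1 Y1 r c).
Proof.
move=> ss' opt sX sY sX1 sY1; case/andP: (ss') => le s'L; have sL := leq_trans le s'L.
have sLL : (s <= L <= L)%N by rewrite sL leqnn.
have /choice[Pi PiP] k : exists Pi : nat -> nat -> C, (k < N s)%N ->
  [/\ forall i i', Pi i i' != 0 -> S 0 s i k && S 0 s i' k,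
      forall (i : 'I_(N 0)) (c : 'I_(N L)), S 0 s i k -> S s L k c ->
        \sum_(j < N s | cl s k j) X i j * Y j c = \sum_(i' < N 0) Pi i i' * B i' c &
      forall v : nat -> C,
        \sum_(i < N 0 | S 0 s i k) sq (\sum_(i' < N 0) Pi i i' * v i') <=
        \sum_(i < N 0 | S 0 s i k) sq (v i)].
  have [kN|kN] := ltnP k (N s); last by exists (fun _ _ => 0).
  by have [|Pi PiP] := bopt_projection _ (opt k kN); [apply: (card_cl_left IF)|exists Pi].
(* The projector applied to column [k'] is that of the [s]-block with the residue of [r] and the
   level of [k']. *)
pose X2 r k' : C := \sum_(r' < N 0) Pi (rep s s' r k') r r' * X1 r' k'.
have sX2 : fsupp 0 s' X2.
  move=> r k' /sum_neq0[r' _ /mul_neq0[Pinz /sX1 Sr'k']].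
  have k'N : (k' < N s')%N by case/and4P: Sr'k'.
  have kN := rep_lt IF r ss' k'N.
  have [Pisup _ _] := PiP _ kN; have /andP[Srk Sr'k] := Pisup _ _ Pinz.
  case/and4P: Sr'k' => _ _ /eqP l' /eqP m'; case/and4P: Srk => rN _ /eqP l /eqP m.
  case/and4P: Sr'k => _ _ /eqP l1 /eqP m1; apply/and4P; split=> //; apply/eqP.
    by rewrite l -l1.
  by rewrite -m'; apply: (mod_eqW IF ss'); rewrite m -m1.
have prodE (r : 'I_(N 0)) (c : 'I_(N L)) : S 0 L r c ->
    fmul (N s) X Y r c - fmul (N s') X2 Y1 r c =
    \sum_(r' < N 0) Pi (rep s L r c) r r' * (B r' c - fmul (N s') X1 Y1 r' c).
  move=> Src; have [Sr Sc] := repP IF (leq0n s) sLL Src.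
  have [_ PiE _] := PiP _ (rep_lt IF r sLL (ltn_ord c)).
  under eq_bigr do rewrite mulrBr.
  rewrite sumrB -(PiE _ _ Sr Sc) (fmul_class sX sY Sr Sc); congr (_ - _).
  rewrite /fmul; under [RHS]eq_bigr do rewrite mulr_sumr.
  rewrite [RHS]exchange_big; apply: eq_bigr => k' _.
  have [->|/sY1 Sk'] := eqVneq (Y1 k' c) 0.
    by rewrite mulr0 big1 // => r' _; rewrite !mulr0.
  rewrite mulr_suml; apply: eq_bigr => r' _; rewrite mulrA.
  (* The projector does not depend on the summation index: [k'] and [c] have equal level at [s'],
     hence at the coarser [s]. *)
  have -> // : rep s s' r k' = rep s L r c.
  rewrite /rep; congr (mk _ _ _ _ _); case/and4P: Sk' => _ _ /eqP l _.
  by apply: (lev_eqW IF le) l; rewrite ?s'L ?leqnn.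
exists X2 => //; rewrite !(fn2_blocks _ sL); apply: lerD.
  rewrite big1 => [|[r c] /= nS]; first by apply: sumr_ge0 => x _; apply: sq_ge0.
  by rewrite (fmul_off sL sX sY) // (fmul_off s'L sX2 sY1) // subrr sq0.
apply: ler_sum => k krep; rewrite exchange_big [leRHS]exchange_big /=.
apply: ler_sum => c Sc; have [_ _ cPi] := PiP k (ltn_ord k).
apply: le_trans (cPi (fun r => B r c - fmul (N s') X1 Y1 r c)).
rewrite le_eqVlt; apply/orP; left; apply/eqP; apply: eq_bigr => r Sr.
rewrite prodE ?(rep_uniq Sr Sc) -?(eqP krep) //.
exact: (bsup_mono IF (leq0n s) sLL Sr Sc).
Qed.

(** Right projections act on the columns of [Y1] inside the column sets at [s], which lie within the
    column sets of any cut further left. *)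
Lemma optimal_contract_right s s' B X Y X1 Y1 : (s' <= s <= L)%N -> optimal s B X Y ->
  fsupp 0 s X -> fsupp s L Y -> fsupp 0 s' X1 -> fsupp s' L Y1 ->
  exists2 Y2, fsupp s' L Y2 &
  fn2 (fun r c => fmul (N s) X Y r c - fmul (N s') X1 Y2 r c) <=
  fn2 (fun r c => B r c - fmul (N s') X1 Y1 r c).
Proof.
move=> ss' opt sX sY sX1 sY1; case/andP: (ss') => le sL; have s'L := leq_trans le sL.
have sLL : (s <= L <= L)%N by rewrite sL leqnn.
have /choice[Pi PiP] k : exists Pi : nat -> nat -> C, (k < N s)%N ->
  [/\ forall i i', Pi i i' != 0 -> S s L k i && S s L k i',
      forall (c : 'I_(N L)) (r : 'I_(N 0)), S s L k c -> S 0 s r k ->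
        \sum_(j < N s | cl s k j) Y j c * X r j = \sum_(c' < N L) Pi c c' * B r c' &
      forall v : nat -> C,
        \sum_(c < N L | S s L k c) sq (\sum_(c' < N L) Pi c c' * v c') <=
        \sum_(c < N L | S s L k c) sq (v c)].
  have [kN|kN] := ltnP k (N s); last by exists (fun _ _ => 0).
  by have [|Pi PiP] := bopt_projection _ (bopt_tr (opt k kN)); [apply: (card_cl_right IF)|exists Pi].
pose Y2 k' c : C :=
  (* The guard ensures that [rep s L k' c] is a valid index; in the left case this came from the
     support of [X1]. *)
  if (c < N L)%N then \sum_(c' < N L) Pi (rep s L k' c) c c' * Y1 k' c' else 0.
have sY2 : fsupp s' L Y2.
  move=> k' c; rewrite /Y2; case: ifP => [cN|]; last by rewrite eqxx.
  move=> /sum_neq0[c' _ /mul_neq0[Pinz /sY1 Sk'c']]; have kN := rep_lt IF k' sLL cN.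
  have [Pisup _ _] := PiP _ kN; have /andP[Skc Skc'] := Pisup _ _ Pinz.
  case/and4P: Sk'c' => k'N _ /eqP l' /eqP m'; case/and4P: Skc => _ _ /eqP l /eqP m.
  case/and4P: Skc' => _ _ /eqP l1 /eqP m1; apply/and4P; split=> //; apply/eqP.
    by rewrite l'; apply: (lev_eqW IF le); rewrite ?sL ?leqnn // -l -l1.
  by rewrite m' -m1 m.
have prodE (r : 'I_(N 0)) (c : 'I_(N L)) : S 0 L r c ->
    fmul (N s) X Y r c - fmul (N s') X1 Y2 r c =
    \sum_(c' < N L) Pi (rep s L r c) c c' * (B r c' - fmul (N s') X1 Y1 r c').
  move=> Src; have [Sr Sc] := repP IF (leq0n s) sLL Src.
  have [_ PiE _] := PiP _ (rep_lt IF r sLL (ltn_ord c)).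
  under eq_bigr do rewrite mulrBr.
  rewrite sumrB -(PiE _ _ Sc Sr) (fmul_class sX sY Sr Sc); congr (_ - _).
    by apply: eq_bigr => k' _; rewrite mulrC.
  rewrite /fmul; under [RHS]eq_bigr do rewrite mulr_sumr.
  rewrite [RHS]exchange_big; apply: eq_bigr => k' _.
  have [->|/sX1 Sk'] := eqVneq (X1 r k') 0.
    by rewrite mul0r big1 // => c' _; rewrite mul0r mulr0.
  rewrite /Y2 ltn_ord mulr_sumr; apply: eq_bigr => c' _; rewrite mulrCA.
  (* [r] and [k'] have equal residue at [s'], hence at the coarser modulus of [s]. *)
  have -> // : rep s L k' c = rep s L r c.
  rewrite /rep; congr (mk _ _ _ _ _); case/and4P: Sk' => _ _ _ /eqP m.
  by apply/esym/(mod_eqW IF ss').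
exists Y2 => //; rewrite !(fn2_blocks _ sL); apply: lerD.
  rewrite big1 => [|[r c] /= nS]; first by apply: sumr_ge0 => x _; apply: sq_ge0.
  by rewrite (fmul_off sL sX sY) // (fmul_off s'L sX1 sY2) // subrr sq0.
apply: ler_sum => k krep; apply: ler_sum => r Sr; have [_ _ cPi] := PiP k (ltn_ord k).
apply: le_trans (cPi (fun c => B r c - fmul (N s') X1 Y1 r c)).
rewrite le_eqVlt; apply/orP; left; apply/eqP; apply: eq_bigr => c Sc.
rewrite prodE ?(rep_uniq Sr Sc) -?(eqP krep) //.
exact: (bsup_mono IF (leq0n s) sLL Sr Sc).
Qed.

End Contraction.

(** * The butterfly algorithm *)

Section Passes.
Variables (R : realType) (beta : seq pattern).
Local Notation C := (R[i]).
Local Notation L := (size beta).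
Hypotheses (L_gt0 : (0 < L)%N) (arch : is_arch beta) (chain : chainable_arch beta)
  (nred : ~ redundant_arch beta).
Local Notation N := (Nv beta).
Local Notation S := (bsup (Nv beta) (alv beta) (dev beta)).
Local Notation CL := (cl (Nv beta) (alv beta) (dev beta)).
Local Notation fs := (@fsupp R (Nv beta) (alv beta) (dev beta)).
Local Notation isf := (@isfac beta R).
Let IFA : ifaces L N (alv beta) (dev beta) := ifaces_arch L_gt0 arch chain nred.

Definition mkx n m (f : nat -> nat -> C) : mxs R := MX (\matrix_(i < n, j < m) f i j).

Lemma ent_mkx n m f i j : ent (mkx n m f) i j = if (i < n)%N && (j < m)%N then f i j else 0.
Proof.
rewrite /ent /=; case: insubP => [i' -> <-|/negPf -> //].
by case: insubP => [j' -> <-|/negPf -> //]; rewrite mxE.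
Qed.

Lemma isfac_mkx u t f : fs u t f -> isf u t (mkx (N u) (N t) f).
Proof.
by move=> sf; split=> // i j; rewrite ent_mkx; case: ifP => // _; [apply: sf|rewrite eqxx].
Qed.

Lemma ent_fsupp u t f : fs u t f -> ent (mkx (N u) (N t) f) =2 f.
Proof.
move=> sf i j; rewrite ent_mkx; case: ifP => // h; apply/esym/eqP.
by apply: contraFT h => /sf/and4P[-> ->].
Qed.

(** With predicates and summands on [nat], the bound of an ordinal sum can be changed without
    dependent rewriting. *)
Lemma eq_sum_ord (V : nmodType) (n n' : nat) (P P' : pred nat) (F F' : nat -> V) : n = n' ->
  (forall i, (i < n')%N -> P i = P' i) ->
  (forall i, (i < n')%N -> P' i -> F i = F' i) ->
  \sum_(i < n | P i) F i = \sum_(i < n' | P' i) F' i.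
Proof.
by move=> -> eP eF; apply: eq_big => [i|i Pi]; [rewrite eP|rewrite eF // -eP].
Qed.

Section Pair.
Variables u s t : nat.
Hypotheses (us : (u < s)%N) (st : (s < t)%N) (tL : (t <= L)%N).
Local Notation q1 := (prodpat beta u.+1 s).
Local Notation q2 := (prodpat beta s.+1 t).

Let sL : (s <= L)%N. Proof. exact: leq_trans (ltnW st) tL. Qed.
Let usL : (u < s <= L)%N. Proof. by rewrite us sL. Qed.
Let stL : (s < t <= L)%N. Proof. by rewrite st. Qed.
Let usL' : (u <= s <= L)%N. Proof. by rewrite ltnW. Qed.
Let stL' : (s <= t <= L)%N. Proof. by rewrite ltnW. Qed.
Let pr1 : prows q1 = N u. Proof. exact: prows_prodpat. Qed.
Let pc1 : pcols q1 = N s. Proof. exact: pcols_prodpat. Qed.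
Let pc2 : pcols q2 = N t. Proof. exact: pcols_prodpat. Qed.
Let RPE k r : (k < N s)%N -> inRP q1 q2 k r = S u s r k.
Proof. exact: inRP_bsup. Qed.
Let CPE k c : (k < N s)%N -> inCP q1 q2 k c = S s t k c.
Proof. exact: inCP_bsup. Qed.
Let PE k k' : (k < N s)%N -> inP q1 q2 k k' = CL s k k'.
Proof. exact: inP_cl. Qed.
Let bsE (X Y : mxs R) : block_supported q1 q2 X Y <-> isf u s X /\ isf s t Y.
Proof. exact: block_supportedE. Qed.

Let sum1 k (F : nat -> C) : (k < N s)%N ->
  \sum_(r < prows q1 | inRP q1 q2 k r) F r = \sum_(r < N u | S u s r k) F r.
Proof.
move=> kN; apply: (@eq_sum_ord _ _ _ (inRP q1 q2 k) (S u s ^~ k) F F) => // r _.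
exact: RPE.
Qed.

Let sum2 k (F : nat -> C) : (k < N s)%N ->
  \sum_(c < pcols q2 | inCP q1 q2 k c) F c = \sum_(c < N t | S s t k c) F c.
Proof.
move=> kN; apply: (@eq_sum_ord _ _ _ (inCP q1 q2 k) (S s t k) F F) => // r _.
exact: CPE.
Qed.

Let sumP k (F : nat -> C) : (k < N s)%N ->
  \sum_(j < pcols q1 | inP q1 q2 k j) F j = \sum_(j < N s | CL s k j) F j.
Proof.
move=> kN; apply: (@eq_sum_ord _ _ _ (inP q1 q2 k) (CL s k) F F) => // r _.
exact: PE.
Qed.

Lemma blockerrE M k (H K : nat -> nat -> C) : (k < N s)%N ->
  blockerr q1 q2 M k H K =
  Num.sqrt (berr (N u) (N t) (N s) (S u s ^~ k) (S s t k) (CL s k) (ent M) H K).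
Proof.
move=> kN; rewrite /blockerr /berr; congr Num.sqrt.
pose G (r c : nat) := cnorm (ent M r c - \sum_(j < N s | CL s k j) H r j * K j c) ^+ 2.
rewrite (@eq_sum_ord R (prows q1) (N u) (inRP q1 q2 k) (S u s ^~ k)
  (fun r => \sum_(c < pcols q2 | inCP q1 q2 k c)
     cnorm (ent M r c - \sum_(j < pcols q1 | inP q1 q2 k j) H r j * K j c) ^+ 2)
  (fun r => \sum_(c < N t | S s t k c) G r c)) // => r _ => [|_]; first exact: RPE.
apply: (@eq_sum_ord R (pcols q2) (N t) (inCP q1 q2 k) (S s t k)
   (fun c => cnorm (ent M r c - \sum_(j < pcols q1 | inP q1 q2 k j) H r j * K j c) ^+ 2)
   (G r)) => // c _; first exact: CPE.
by rewrite /G (sumP (fun j => H r j * K j c)).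
Qed.

Lemma twofactorP (M X Y : mxs R) : twofactor q1 q2 M X Y ->
  [/\ isf u s X, isf s t Y & forall k, (k < N s)%N ->
     bopt (N u) (N t) (N s) (S u s ^~ k) (S s t k) (CL s k) (ent M) (ent X) (ent Y)].
Proof.
move=> [/bsE[fX fY] opt]; split=> // k kN H K.
have := opt k; rewrite {1}pc1 => /(_ kN H K); rewrite !blockerrE // ler_sqrt //.
exact: berr_ge0.
Qed.

Lemma rep_cl k k' : CL s k k' ->
  mk N (alv beta) s (lev N (alv beta) s s k) (k %% dev beta s) =
  mk N (alv beta) s (lev N (alv beta) s s k') (k' %% dev beta s).
Proof. by move=> /and4P[_ _ /eqP -> /eqP ->]. Qed.

Lemma cl_rep k : (k < N s)%N ->
  CL s k (mk N (alv beta) s (lev N (alv beta) s s k) (k %% dev beta s)).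
Proof.
move=> kN; have sLL : (s <= s <= L)%N by rewrite leqnn.
have [] := @mk_gen _ _ _ _ IFA s s s (lev N (alv beta) s s k) (k %% dev beta s) sLL sLL.
- exact: lev_lt IFA _ _ _ _ _.
- by rewrite ltn_mod (de_gt0 IFA).
by rewrite -/(mk _ _ _ _ _) => h1 h2 h3; rewrite /cl kN h1 h2 h3 !eqxx.
Qed.

Lemma CL_eq k k' : CL s k k' -> CL s k = CL s k'.
Proof.
move=> h; apply: funext => j; apply/idP/idP; apply: cl_trans => //.
by rewrite cl_sym.
Qed.

(** [ortho] quantifies over all indices, so every member of a class must receive the same
    decomposition; it is therefore chosen at the canonical representative. *)
Lemma qr_classes n (P : nat -> pred nat) (X : nat -> nat -> C) :
  (forall k k', CL s k k' -> P k = P k') -> (forall k r, P k r -> (r < n)%N) ->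
  (forall k, (k < N s)%N ->
     (#|[pred j : 'I_(N s) | CL s k j]| <= #|[pred r : 'I_n | P k r]|)%N) ->
  exists Q Rm : nat -> nat -> nat -> C,
  (forall k k', CL s k k' -> Q k = Q k' /\ Rm k = Rm k') /\
  forall k, (k < N s)%N ->
  [/\ forall j j', CL s k j -> CL s k j' -> (j' < j)%N -> Rm k j j' = 0,
      forall j j', CL s k j -> CL s k j' ->
        \sum_(r < n | P k r) conjc (Q k r j) * Q k r j' = (j == j')%:R &
      forall r j, P k r -> CL s k j ->
        X r j = \sum_(j' < N s | CL s k j') Q k r j' * Rm k j' j].
Proof.
move=> Pcl Pn card.
have /choice[QR QRP] k : exists QR : (nat -> nat -> C) * (nat -> nat -> C), (k < N s)%N ->
  [/\ forall j j', CL s k j -> CL s k j' -> (j' < j)%N -> QR.2 j j' = 0,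
      forall j j', CL s k j -> CL s k j' ->
        \sum_(r < n | P k r) conjc (QR.1 r j) * QR.1 r j' = (j == j')%:R &
      forall r j, P k r -> CL s k j ->
        X r j = \sum_(j' < N s | CL s k j') QR.1 r j' * QR.2 j' j].
  have [kN|kN] := ltnP k (N s); last by exists (fun _ _ => 0, fun _ _ => 0).
  have [Q [Rm [h1 h2 h3]]] := qr_exists X (card k kN).
  exists (Q, Rm) => _; split=> /=.
  - move=> j j' cj cj'; have jN : (j < N s)%N by case/and4P: cj.
    have j'N : (j' < N s)%N by case/and4P: cj'.
    exact: (h1 (Ordinal jN) (Ordinal j'N)).
  - move=> j j' cj cj'; have jN : (j < N s)%N by case/and4P: cj.
    have j'N : (j' < N s)%N by case/and4P: cj'.
    exact: (h2 (Ordinal jN) (Ordinal j'N)).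
  - move=> r j Pr cj; have jN : (j < N s)%N by case/and4P: cj.
    exact: (h3 (Ordinal (Pn _ _ Pr)) (Ordinal jN)).
pose rp k := mk N (alv beta) s (lev N (alv beta) s s k) (k %% dev beta s).
exists (fun k => (QR (rp k)).1), (fun k => (QR (rp k)).2); split.
  by move=> k k' /rep_cl; rewrite -/(rp k) -/(rp k') => ->.
move=> k kN; have ck := cl_rep kN; rewrite -/(rp k) in ck.
have rN : (rp k < N s)%N by case/and4P: ck.
by rewrite (Pcl _ _ ck) (CL_eq ck); apply: QRP.
Qed.

(** Blockwise the triangular factor merely moves across the product; off the support both products
    vanish. *)
Lemma ortho_prodP dir (X Y X' Y' : mxs R) : Defs.ortho dir q1 q2 X Y X' Y' ->
  isf u s X -> isf s t Y ->
  [/\ isf u s X', isf s t Y' &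
      fmul (N s) (ent X') (ent Y') = fmul (N s) (ent X) (ent Y)].
Proof.
move=> [/bsE[fX' fY'] h] fX fY; split=> //.
have [_ _ sX] := fX; have [_ _ sY] := fY.
have [_ _ sX'] := fX'; have [_ _ sY'] := fY'.
apply: funext => r; apply: funext => c.
have [Src|nS] := boolP (S u t r c); last first.
  have off f g : fs u s f -> fs s t g -> fmul (N s) f g r c = 0.
    move=> sf sg; apply/eqP; apply: contraNT nS.
    exact: (fsupp_fmul IFA (ltnW us) stL' sf sg).
  by rewrite !off.
have [Sr Sc] := repP IFA (ltnW us) stL' Src.
set k := rep _ _ _ _ _ _ _ in Sr Sc.
have kN : (k < N s)%N by case/and4P: Sc.
rewrite (fmul_class sX' sY' Sr Sc) (fmul_class sX sY Sr Sc).
have := h k; rewrite {1}pc1 => /(_ kN)[Q [Rm [_]]].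
have Rr : inRP q1 q2 k r by rewrite RPE.
have Cc : inCP q1 q2 k c by rewrite CPE.
case: dir {h} => [[_ hX hX' hY']|[_ hY hY' hX']].
  transitivity (\sum_(j < N s | CL s k j) Q r j *
      \sum_(j' < N s | CL s k j') Rm j j' * ent Y j' c).
    apply: eq_bigr => j cj; rewrite hX' ?hY' ?PE //.
    by rewrite (sumP (fun j' => Rm j j' * ent Y j' c)).
  under eq_bigr do rewrite mulr_sumr.
  rewrite exchange_big; apply: eq_bigr => j cj.
  rewrite hX ?PE // (sumP (fun j' => Q r j' * Rm j' j)) // mulr_suml.
  by apply: eq_bigr => j' _; rewrite mulrA.
transitivity (\sum_(j < N s | CL s k j)
    (\sum_(j' < N s | CL s k j') ent X r j' * Rm j j') * Q c j).
  apply: eq_bigr => j cj; rewrite hX' ?hY' ?PE //.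
  by rewrite (sumP (fun j' => ent X r j' * Rm j j')).
under eq_bigr do rewrite mulr_suml.
rewrite exchange_big; apply: eq_bigr => j cj.
rewrite hY ?PE // (sumP (fun j' => Q c j' * Rm j' j)) // mulr_sumr.
by apply: eq_bigr => j' _; rewrite -mulrA [Rm _ _ * _]mulrC.
Qed.

Lemma ortho_colP (X Y X' Y' : mxs R) : Defs.ortho OCol q1 q2 X Y X' Y' ->
  forall k k', CL s k k' ->
    \sum_(i < N u | S u s i k) conjc (ent X' i k) * ent X' i k' = (k == k')%:R.
Proof.
move=> [_ h] k k' ck; have kN : (k < N s)%N by case/and4P: ck.
have := h k; rewrite {1}pc1 => /(_ kN)[Q [Rm [_ [o _ hX' _]]]].
have kk : inP q1 q2 k k by rewrite PE ?cl_refl.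
have kk' : inP q1 q2 k k' by rewrite PE.
rewrite -(o _ _ kk kk') (sum1 (fun r => conjc (Q r k) * Q r k')) //.
by apply: eq_bigr => r Sr; rewrite !hX' ?RPE.
Qed.

Lemma ortho_rowP (X Y X' Y' : mxs R) : Defs.ortho ORow q1 q2 X Y X' Y' ->
  forall k k', CL s k k' ->
    \sum_(j < N t | S s t k j) conjc (ent Y' k j) * ent Y' k' j = (k == k')%:R.
Proof.
move=> [_ h] k k' ck; have kN : (k < N s)%N by case/and4P: ck.
have := h k; rewrite {1}pc1 => /(_ kN)[Q [Rm [_ [o _ hY' _]]]].
have kk : inP q1 q2 k k by rewrite PE ?cl_refl.
have kk' : inP q1 q2 k k' by rewrite PE.
rewrite -(o _ _ kk kk') (sum2 (fun c => conjc (Q c k) * Q c k')) //.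
by apply: eq_bigr => r Sr; rewrite !hY' ?CPE.
Qed.

Lemma ortho_exists dir (X Y : mxs R) : exists X' Y', Defs.ortho dir q1 q2 X Y X' Y'.
Proof.
have Sl k k' : CL s k k' -> (S u s ^~ k) = (S u s ^~ k').
  by move=> ck; apply: funext => r; rewrite (bsup_clr IFA r usL' ck).
have Sr k k' : CL s k k' -> S s t k = S s t k'.
  by move=> ck; apply: funext => c; rewrite (bsup_cll IFA c stL' ck).
case: dir.
- have [] := @qr_classes (N u) (fun k => S u s ^~ k) (ent X) Sl.
  + by move=> k r /and4P[].
  + by move=> k kN; apply: (card_cl_left IFA).
  move=> Q [Rm [QC QRP]].
  (* Each column uses the decomposition attached to its own index; constancy on classes identifies
     it with that of any other member. *)
  pose Xf r j : C := if S u s r j then Q j r j else 0.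
  pose Yf j c : C := if S s t j c
    then \sum_(j' < N s | CL s j j') Rm j j j' * ent Y j' c else 0.
  have sXf : fs u s Xf by move=> i j; rewrite /Xf; case: ifP => //; rewrite eqxx.
  have sYf : fs s t Yf by move=> i j; rewrite /Yf; case: ifP => //; rewrite eqxx.
  exists (mkx (N u) (N s) Xf), (mkx (N s) (N t) Yf); split.
    by apply/bsE; split; apply: isfac_mkx.
  move=> i; rewrite {1}pc1 => iN; exists (Q i), (Rm i); have [h1 h2 h3] := QRP _ iN.
  split; first by move=> j j'; rewrite !PE //; apply: h1.
  split.
  + by move=> j j'; rewrite !PE // (sum1 (fun r => conjc (Q i r j) * Q i r j')) //; apply: h2.
  + move=> r j; rewrite RPE // PE // (sumP (fun j' => Q i r j' * Rm i j' j)) //.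
    exact: h3.
  + move=> r j; rewrite RPE // PE // ent_fsupp // /Xf => + cj.
    by rewrite (bsup_clr IFA r usL' cj) => ->; have [-> _] := QC _ _ cj.
  + move=> j c; rewrite CPE // PE // ent_fsupp // /Yf => cj.
    rewrite (bsup_cll IFA c stL' cj) => ->; have [_ e] := QC _ _ cj.
    by rewrite (sumP (fun j' => Rm i j j' * ent Y j' c)) // -(CL_eq cj) e.
- have [] := @qr_classes (N t) (fun k => S s t k) (fun c j => ent Y j c) Sr.
  + by move=> k r /and4P[].
  + by move=> k kN; apply: (card_cl_right IFA).
  move=> Q [Rm [QC QRP]].
  pose Yf j c : C := if S s t j c then Q j c j else 0.
  pose Xf r j : C := if S u s r j
    then \sum_(j' < N s | CL s j j') ent X r j' * Rm j j j' else 0.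
  have sXf : fs u s Xf by move=> i j; rewrite /Xf; case: ifP => //; rewrite eqxx.
  have sYf : fs s t Yf by move=> i j; rewrite /Yf; case: ifP => //; rewrite eqxx.
  exists (mkx (N u) (N s) Xf), (mkx (N s) (N t) Yf); split.
    by apply/bsE; split; apply: isfac_mkx.
  move=> i; rewrite {1}pc1 => iN; exists (Q i), (Rm i); have [h1 h2 h3] := QRP _ iN.
  split; first by move=> j j'; rewrite !PE //; apply: h1.
  split.
  + by move=> j j'; rewrite !PE // (sum2 (fun c => conjc (Q i c j) * Q i c j')) //; apply: h2.
  + move=> j c; rewrite CPE // PE // (sumP (fun j' => Q i c j' * Rm i j' j)) // => cj Sc.
    exact: h3.
  + move=> j c; rewrite CPE // PE // ent_fsupp // /Yf => cj.
    by rewrite (bsup_cll IFA c stL' cj) => ->; have [-> _] := QC _ _ cj.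
  + move=> r j; rewrite RPE // PE // ent_fsupp // /Xf => + cj.
    rewrite (bsup_clr IFA r usL' cj) => ->; have [_ e] := QC _ _ cj.
    by rewrite (sumP (fun j' => ent X r j' * Rm i j j')) // -(CL_eq cj) e.
Qed.

Lemma twofactor_exists (M : mxs R) : exists X Y, twofactor q1 q2 M X Y.
Proof.
have /choice[HK HKP] k : exists HK : (nat -> nat -> C) * (nat -> nat -> C), (k < N s)%N ->
    bopt (N u) (N t) (N s) (S u s ^~ k) (S s t k) (CL s k) (ent M) HK.1 HK.2.
  have [kN|kN] := ltnP k (N s); last by exists (fun _ _ => 0, fun _ _ => 0).
  have le : (#|[pred j : 'I_(N s) | CL s k j]| <= N u)%N.
    apply: leq_trans (card_cl_left IFA usL' kN) _.
    by apply: leq_trans (max_card _) _; rewrite card_ord.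
  by have [H [K opt]] := best_approx_block (N t) (S u s ^~ k) (S s t k) (ent M) le;
    exists (H, K).
(* One minimizer per class, chosen at the representative, so that the assembled columns and rows
   belong to the same pair. *)
pose rp k := mk N (alv beta) s (lev N (alv beta) s s k) (k %% dev beta s).
pose Xf r j : C := if S u s r j then (HK (rp j)).1 r j else 0.
pose Yf j c : C := if S s t j c then (HK (rp j)).2 j c else 0.
have sXf : fs u s Xf by move=> i j; rewrite /Xf; case: ifP => //; rewrite eqxx.
have sYf : fs s t Yf by move=> i j; rewrite /Yf; case: ifP => //; rewrite eqxx.
exists (mkx (N u) (N s) Xf), (mkx (N s) (N t) Yf); split.
  by apply/bsE; split; apply: isfac_mkx.
move=> i; rewrite {1}pc1 => iN H K; rewrite !blockerrE // ler_wsqrtr //.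
have ci := cl_rep iN; rewrite -/(rp i) in ci.
have rN : (rp i < N s)%N by case/and4P: ci.
have Sl : (S u s ^~ i) = (S u s ^~ (rp i)).
  by apply: funext => r; rewrite (bsup_clr IFA r usL' ci).
have Sr : S s t i = S s t (rp i).
  by apply: funext => c; rewrite (bsup_cll IFA c stL' ci).
rewrite Sl Sr (CL_eq ci); apply: le_trans (HKP _ rN H K).
rewrite le_eqVlt; apply/orP; left; apply/eqP; rewrite /berr.
apply: eq_bigr => r Sr'; apply: eq_bigr => c Sc'; congr (cnorm (_ - _) ^+ 2).
apply: eq_bigr => j cj; rewrite !ent_fsupp // /Xf /Yf.
have cij : CL s i j by apply: cl_trans ci cj.
rewrite -(bsup_clr IFA r usL' cj) -(bsup_cll IFA c stL' cj) Sr' Sc'.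
by have := rep_cl cij; rewrite -/(rp i) -/(rp j) => <-.
Qed.

End Pair.
End Passes.

(** * States of the algorithm and the two QR passes *)

Section States.
Variables (R : realType) (beta : seq pattern).
Local Notation C := (R[i]).
Local Notation L := (size beta).
Hypotheses (L_gt0 : (0 < L)%N) (arch : is_arch beta) (chain : chainable_arch beta)
  (nred : ~ redundant_arch beta).
Local Notation N := (Nv beta).
Local Notation fs := (@fsupp R (Nv beta) (alv beta) (dev beta)).
Local Notation isf := (@isfac beta R).
Local Notation state := (state R).
Let IFA : ifaces L N (alv beta) (dev beta) := ifaces_arch L_gt0 arch chain nred.

Lemma ent_mulx (A B : mxs R) : ent (mulx A B) = fmul (nc A) (ent A) (ent B).
Proof.
apply: funext => i; apply: funext => j; rewrite /fmul.
have off : ~ (i < nr A)%N \/ ~ (j < nc B)%N ->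
    0 = \sum_(k < nc A) ent A i k * ent B k j.
  move=> h; rewrite big1 // => k _; apply/eqP; rewrite mulf_eq0.
  apply/negPn/negP; rewrite negb_or => /andP[/ent_neq0[iA _] /ent_neq0[_ jB]].
  by case: h.
rewrite {1}/ent; case: insubP => [i' _ ei|/negP ni]; last by apply: off; left.
case: insubP => [j' _ ej|/negP nj]; last by apply: off; right.
by rewrite mxE -ei -ej; apply: eq_bigr => k _; rewrite ent_Ordinal.
Qed.

(** The 1-based interval [[q, t]] spans the interfaces [q - 1] and [t], so consecutive intervals
    share an interface. *)
Fixpoint wf u (st : state) v : Prop :=
  if st is ((q, t), X) :: st' then [/\ q = u.+1, (u < t)%N, isf u t X & wf t st' v]
  else u = v.

(** The empty product is the identity truncated at [N u]: it is supported and neutral for supported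
    functions. *)
Fixpoint stprod u (st : state) : nat -> nat -> C :=
  if st is ((_, t), X) :: st' then fmul (N t) (ent X) (stprod t st')
  else fun i j => ((i == j) && (i < N u)%N)%:R.

Lemma wf_cat u st1 st2 v : wf u (st1 ++ st2) v <-> exists w, wf u st1 w /\ wf w st2 v.
Proof.
elim: st1 u => [|[[q t] X] st1 IH] u /=; split=> [h|[w]].
- by exists u.
- by case=> ->.
- by case: h => -> ut fX /IH[w [h1 h2]]; exists w.
- by case=> -[-> ut fX h1] h2; split=> //; apply/IH; exists w.
Qed.

Lemma wf_size u st v : wf u st v -> (u + size st <= v)%N.
Proof.
elim: st u => [|[[q t] X] st IH] u /=; first by move->; rewrite addn0.
by case=> _ ut _ /IH; apply: leq_trans; rewrite addnS -addSn leq_add2r.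
Qed.

Lemma wf_le u st v : wf u st v -> (u <= v)%N.
Proof. by move/wf_size; apply: leq_trans; rewrite leq_addr. Qed.

Lemma fsupp_stprod u st v : wf u st v -> (v <= L)%N -> fs u v (stprod u st).
Proof.
elim: st u => [|[[q t] X] st IH] u /=.
  move=> <- _ i j; have [<-|ne] := eqVneq i j; last by rewrite eqxx.
  by have [iN _|] := ltnP i (N u); [apply: bsup_refl|rewrite eqxx].
case=> _ ut [_ _ sX] w vL.
by apply: (fsupp_fmul IFA (ltnW ut) _ sX (IH _ w vL)); rewrite (wf_le w).
Qed.

Lemma fmul_id u v f : fs u v f ->
  fmul (N u) (fun i j => ((i == j) && (i < N u)%N)%:R) f = f.
Proof.
move=> sf; apply: funext => i; apply: funext => j; rewrite /fmul.
have [iN|iN] := ltnP i (N u); last first.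
  rewrite big1 => [|k _]; last by rewrite andbF mul0r.
  by apply/esym/eqP; apply: contraTT iN => /sf/and4P[iN]; rewrite -ltnNge.
rewrite (bigD1 (Ordinal iN)) //= eqxx mul1r big1 ?addr0 // => k nk.
have /negPf -> : i != k by apply: contra nk => /eqP e; apply/eqP/val_inj.
by rewrite mul0r.
Qed.

Lemma fmul_idr (n : nat) f : (forall i j, f i j != 0 -> (j < n)%N) ->
  fmul n f (fun i j => ((i == j) && (i < n)%N)%:R) = f :> (nat -> nat -> C).
Proof.
move=> sf; apply: funext => i; apply: funext => j; rewrite /fmul.
have [jN|jN] := ltnP j n; last first.
  rewrite big1 => [|k _].
    by apply/esym/eqP; apply: contraTT jN => /sf; rewrite -ltnNge.
  by have [e|_] := eqVneq (val k) j; rewrite ?mulr0 //; move: jN; rewrite -e leqNgt ltn_ord.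
rewrite (bigD1 (Ordinal jN)) //= eqxx jN mulr1 big1 ?addr0 // => k nk.
have /negPf -> : nat_of_ord k != j by apply: contra nk => /eqP e; apply/eqP/val_inj.
by rewrite mulr0.
Qed.

Lemma stprod_cat u st1 w st2 v : wf u st1 w -> wf w st2 v -> (v <= L)%N ->
  stprod u (st1 ++ st2) = fmul (N w) (stprod u st1) (stprod w st2).
Proof.
move=> w1 w2 vL; elim: st1 u w1 => [|[[q t] X] st1 IH] u /=.
  by move=> ->; rewrite (fmul_id (fsupp_stprod w2 vL)).
case=> _ ut fX /IH ->; apply: funext => i; apply: funext => j.
exact: fmulA.
Qed.

Lemma stprod_prodx X st v t : wf t st v -> nc X = N t -> (v <= L)%N ->
  ent (foldl (@mulx R) X (map snd st)) = fmul (N t) (ent X) (stprod t st).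
Proof.
move=> w cX vL; elim: st t X w cX => [|[[q t'] Y] st IH] t X /= w cX.
  by rewrite fmul_idr // => i j /ent_neq0[_]; rewrite cX.
case: w => _ tt' [rY cY sY] w; rewrite (IH t') // ent_mulx cX.
by apply: funext => i; apply: funext => j; rewrite fmulA.
Qed.

Lemma set_nth2_cat (T : Type) (d : T) s1 a b a' b' s2 :
  set_nth d (set_nth d (s1 ++ a :: b :: s2) (size s1) a') (size s1).+1 b' =
  s1 ++ a' :: b' :: s2.
Proof. by elim: s1 => //= x s1 ->. Qed.

Lemma split2 (T : Type) (d : T) (s : seq T) k : (1 <= k < size s)%N ->
  exists s1 s2, s = s1 ++ nth d s k.-1 :: nth d s k :: s2 /\ size s1 = k.-1.
Proof.
case: k => // k /= kS; exists (take k s), (drop k.+2 s).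
rewrite size_take (ltn_trans _ kS) //; split=> //.
by rewrite -!drop_nth ?cat_take_drop // ltnW.
Qed.

Lemma cat_eq_size (T : Type) (s1 s2 t1 t2 : seq T) :
  size s1 = size t1 -> s1 ++ s2 = t1 ++ t2 -> s1 = t1 /\ s2 = t2.
Proof.
by elim: s1 t1 => [|x s1 IH] [|y t1] //= [/IH h] [-> /h[-> ->]].
Qed.

Lemma ortho_stepP dir k st st' : wf 0 st L -> ortho_step dir beta k st st' ->
  exists st1 st2 u s t X Y X' Y',
  [/\ st = st1 ++ ((u.+1, s), X) :: ((s.+1, t), Y) :: st2,
      st' = st1 ++ ((u.+1, s), X') :: ((s.+1, t), Y') :: st2,
      k = (size st1).+1,
      wf 0 st1 u /\ wf t st2 L &
      [/\ (u < s)%N, (s < t)%N, isf u s X, isf s t Y &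
          Defs.ortho dir (prodpat beta u.+1 s) (prodpat beta s.+1 t) X Y X' Y']].
Proof.
move=> w [kS]; have [st1 [st2 [e ks1]]] := split2 (dflt_entry R) kS.
move: e; move: (nth _ st k.-1) (nth _ st k) => -[[q s] X] [[q' t] Y] e /=.
move=> [X' [Y' [o e']]].
move: w; rewrite e wf_cat => -[u [w1 /= [eq us fX [eq' st0 fY w2]]]].
subst q q'; exists st1, st2, u, s, t, X, Y, X', Y'; split=> //.
- rewrite e' e -ks1; have -> : k = (size st1).+1 by rewrite ks1 prednK //; case/andP: kS.
  exact: set_nth2_cat.
- by rewrite ks1 prednK //; case/andP: kS.
Qed.

Lemma ortho_step_inv dir k st st' : wf 0 st L -> ortho_step dir beta k st st' ->
  [/\ wf 0 st' L, map fst st' = map fst st & stprod 0 st' = stprod 0 st].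
Proof.
move=> w /(ortho_stepP w)[st1 [st2 [u [s [t [X [Y [X' [Y' []]]]]]]]]].
move=> -> -> _ [w1 w2] [us st0 fX fY o].
have tL := wf_le w2.
have [fX' fY' e] := ortho_prodP L_gt0 arch chain nred us st0 tL o fX fY.
have wr : wf u (((u.+1, s), X') :: ((s.+1, t), Y') :: st2) L by [].
have wr0 : wf u (((u.+1, s), X) :: ((s.+1, t), Y) :: st2) L by [].
split; first by apply/wf_cat; exists u.
  by rewrite !map_cat.
rewrite (stprod_cat w1 wr) // (stprod_cat w1 wr0) //; congr fmul => /=.
apply: funext => i; apply: funext => j.
by rewrite !fmulA e.
Qed.

Lemma ortho_step_ex dir k st : wf 0 st L -> (1 <= k < size st)%N ->
  exists st', ortho_step dir beta k st st'.
Proof.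
move=> w kS; have [st1 [st2 [e ks1]]] := split2 (dflt_entry R) kS.
case e1 : (nth _ st k.-1) e => [[q s] X]; case e2 : (nth _ st k) => [[q' t] Y] e.
have := w; rewrite {1}e wf_cat => -[u [w1 /= [eq us fX [eq' st0 fY w2]]]].
subst q q'; have tL := wf_le w2.
have [X' [Y' o]] := ortho_exists L_gt0 arch chain nred us st0 tL dir X Y.
exists (set_nth (dflt_entry R) (set_nth (dflt_entry R) st k.-1 ((u.+1, s), X')) k
  ((s.+1, t), Y')).
by split=> //=; exists X', Y'; rewrite e1 e2.
Qed.

Lemma rel_seq_ex (T : Type) (Rk : nat -> T -> T -> Prop) (I : T -> Prop) ks x :
  (forall k y, k \in ks -> I y -> exists2 z, Rk k y z & I z) -> I x ->
  exists y, rel_seq Rk ks x y.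
Proof.
elim: ks x => [|k ks IH] x h Ix; first by exists x.
have [z xz Iz] := h k x (mem_head _ _) Ix.
have [|y zy] := IH z _ Iz; last by exists y, z.
by move=> k' y k'ks; apply: h; rewrite in_cons k'ks orbT.
Qed.

Lemma ortho_pass_ex dir ks st : wf 0 st L -> (forall k, k \in ks -> (1 <= k < size st)%N) ->
  exists st', rel_seq (ortho_step dir beta) ks st st'.
Proof.
move=> w h; apply: (rel_seq_ex (I := fun y => wf 0 y L /\ size y = size st)) => //.
move=> k y kks [wy sy]; have [|z yz] := @ortho_step_ex dir k y wy; first by rewrite sy h.
exists z => //; have [wz e _] := ortho_step_inv wy yz; split=> //.
by rewrite -(size_map fst) e size_map.
Qed.

Lemma ortho_pass_inv dir ks st st' : wf 0 st L -> rel_seq (ortho_step dir beta) ks st st' ->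
  [/\ wf 0 st' L, map fst st' = map fst st & stprod 0 st' = stprod 0 st].
Proof.
elim: ks st => [|k ks IH] st w /=; first by move=> ->.
case=> z [/(ortho_step_inv w)[wz ez pz] /(IH _ wz)[w' e' p']].
by rewrite e' p'.
Qed.

Definition corth u (f : nat -> nat -> C) := colorth N (alv beta) u f.
Definition rorth u (f : nat -> nat -> C) := @roworth R L N (dev beta) u f.

(** The prefix stays column-orthonormal; each step appends to it the factor just orthonormalised and
    pushes the triangular part into the rest. *)
Lemma col_pass n k st st' st1 st2 u : st = st1 ++ st2 -> k = (size st1).+1 ->
  wf 0 st1 u -> wf u st2 L -> corth u (stprod 0 st1) ->
  rel_seq (ortho_step OCol beta) (iota k n) st st' ->
  exists st1' st2' u',
  [/\ st' = st1' ++ st2', size st1' = (size st1 + n)%N, wf 0 st1' u', wf u' st2' L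
    & corth u' (stprod 0 st1')].
Proof.
elim: n k st st1 st2 u => [|n IH] k st st1 st2 u est ek w1 w2 oc /=.
  by move=> ->; exists st1, st2, u; rewrite addn0.
have w : wf 0 st L by rewrite est; apply/wf_cat; exists u.
case=> z [/(ortho_stepP w)[a [b [u' [s [t [X [Y [X' [Y' []]]]]]]]]]].
move=> est' ez ek' [wa wb] [us st0 fX fY o] zz.
have sa : size st1 = size a by move: ek'; rewrite ek => -[].
have := est'; rewrite est => /(cat_eq_size sa)[ea eb].
subst a; have eu : u' = u.
  move: w2; rewrite eb /= => -[[->]] //.
subst u'; have tL := wf_le wb.
have [fX' fY' _] := ortho_prodP L_gt0 arch chain nred us st0 tL o fX fY.
have [] := IH k.+1 z (rcons st1 ((u.+1, s), X')) (((s.+1, t), Y') :: b) s _ _ _ _ _ zz.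
- by rewrite ez cat_rcons.
- by rewrite size_rcons ek.
- by rewrite -cats1; apply/wf_cat; exists u.
- by [].
- have wl : wf u [:: ((u.+1, s), X')] s by [].
  have sL := leq_trans (ltnW st0) tL.
  rewrite -cats1 (stprod_cat w1 wl sL) /= fmul_idr; last first.
    by move=> i j /ent_neq0[_]; have [_ ->] := fX'.
  apply: (colorth_fmul IFA) => //; first by rewrite ltnW.
    by case: fX'.
  exact: (ortho_colP L_gt0 arch chain nred us st0 tL o).
by rewrite size_rcons addSnnS => st1' [st2' [u' h]]; exists st1', st2', u'.
Qed.

(** The mirror pass. It stops at the pair whose left member is the interval to be split, so the
    entries before that interval, and with them the result of the column pass, are untouched. *)
Lemma row_pass n j st st' st1 st2 u : (0 < j)%N -> st = st1 ++ st2 -> size st1 = (j + n)%N ->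
  wf 0 st1 u -> wf u st2 L -> rorth u (stprod u st2) ->
  rel_seq (ortho_step ORow beta) (rev (iota j n)) st st' ->
  exists st1' st2' u',
  [/\ st' = st1' ++ st2', size st1' = j, wf 0 st1' u', wf u' st2' L
    & rorth u' (stprod u' st2') /\ take j.-1 st' = take j.-1 st].
Proof.
move=> j0; elim: n st st1 st2 u => [|n IH] st st1 st2 u est es1 w1 w2 oc.
  by move=> /= ->; exists st1, st2, u; rewrite addn0 in es1.
rewrite -addn1 iotaD rev_cat /=.
have w : wf 0 st L by rewrite est; apply/wf_cat; exists u.
case=> z [/(ortho_stepP w)[a [b [u' [s [t [X [Y [X' [Y' []]]]]]]]]]].
move=> est' ez ek' [wa wb] [us st0 fX fY o] zz.
have := est'; rewrite est (_ : a ++ _ =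
  (a ++ [:: ((u'.+1, s), X); ((s.+1, t), Y)]) ++ b); last by rewrite -catA.
move=> /cat_eq_size[|ea eb]; first by rewrite size_cat /= es1; lia.
subst b; have tL := wf_le wb.
have eu : t = u.
  move: w1; rewrite ea wf_cat => -[v [wa' /= [_ _ _ [_ _ _ ->]]]] //.
subst t.
have [fX' fY' _] := ortho_prodP L_gt0 arch chain nred us st0 tL o fX fY.
have [] := IH z (rcons a ((u'.+1, s), X')) (((s.+1, u), Y') :: st2) s _ _ _ _ _ zz.
- by rewrite ez cat_rcons.
- by rewrite size_rcons; lia.
- by rewrite -cats1; apply/wf_cat; exists u'.
- by [].
- apply: (roworth_fmul IFA) => //; first by rewrite ltnW.
    by case: fY'.
  exact: (ortho_rowP L_gt0 arch chain nred us st0 tL o).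
move=> st1' [st2' [u1 [h1 h2 h3 h4 [h5 h6]]]]; exists st1', st2', u1; split=> //.
split=> //; rewrite h6 ez -est est' !take_cat; case: ltnP => // le.
have -> : (j.-1 - size a = 0)%N by lia.
by rewrite !take0.
Qed.

End States.

(** * Invariant of the run and accumulation of errors *)

Section Run.
Variables (R : realType) (beta : seq pattern).
Local Notation C := (R[i]).
Local Notation L := (size beta).
Hypotheses (L_gt1 : (1 < L)%N) (arch : is_arch beta) (chain : chainable_arch beta)
  (nred : ~ redundant_arch beta).
Let L_gt0 : (0 < L)%N := ltnW L_gt1.
Local Notation N := (Nv beta).
Local Notation fs := (@fsupp R (Nv beta) (alv beta) (dev beta)).
Local Notation isf := (@isfac beta R).
Local Notation state := (state R).
Local Notation wf := (@wf R beta).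
Local Notation stprod := (@stprod R beta).
Local Notation fn2 := (@fn2 R L N).
Local Notation fn := (@fn R L N).
Let IFA : ifaces L N (alv beta) (dev beta) := ifaces_arch L_gt0 arch chain nred.

Variables (A : mxs R) (sigma : seq nat).
Hypotheses (rA : nr A = N 0) (cA : nc A = N L)
  (sigmaP : perm_eq sigma (iota 1 L.-1)).

Lemma frob_sub (B : mxs R) : frob (subx A B) = fn (fun r c => ent A r c - ent B r c).
Proof.
rewrite /frob /fn /fn2 /=; congr Num.sqrt.
have -> : \sum_(i < nr A) \sum_(j < nc A) cnorm ((\matrix_(i0, j0) (mxof A i0 j0 - ent B i0 j0)) i j) ^+ 2
  = \sum_(i < nr A) \sum_(j < nc A) cnorm (ent A i j - ent B i j) ^+ 2 :> R.
  by apply: eq_bigr => i _; apply: eq_bigr => j _; rewrite mxE ent_Ordinal.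
by rewrite rA cA.
Qed.

(** The second clause says, without infima, that no remaining cut has become harder: competitors for
    [A] are matched by competitors for the current product [B]. *)
Definition err_inv k (B : nat -> nat -> C) :=
  fn (fun r c => ent A r c - B r c) <= \sum_(i < k) Eerr beta (nth 0%N sigma i) A /\
  forall s', (0 < s' < L)%N -> s' \notin take k sigma ->
  forall X1 Y1, fs 0 s' X1 -> fs s' L Y1 -> exists X2 Y2,
  [/\ fs 0 s' X2, fs s' L Y2 &
      fn2 (fun r c => B r c - fmul (N s') X2 Y2 r c) <=
      fn2 (fun r c => ent A r c - fmul (N s') X1 Y1 r c)].

Lemma size_sigma : size sigma = L.-1.
Proof. by rewrite (perm_size sigmaP) size_iota. Qed.

Lemma sigma_nth k : (k < L.-1)%N ->
  (0 < nth 0 sigma k < L)%N /\ nth 0%N sigma k \notin take k sigma.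
Proof.
move=> kL; have kS : (k < size sigma)%N by rewrite size_sigma.
have := mem_nth 0%N kS; rewrite (perm_mem sigmaP) mem_iota add1n prednK // => ->.
split=> //; have : uniq sigma by rewrite (perm_uniq sigmaP) iota_uniq.
rewrite -{1}(cat_take_drop k sigma) (drop_nth 0%N kS) cat_uniq => /and3P[_ /norP[] //].
Qed.

Lemma err_inv0 : err_inv 0 (ent A).
Proof.
split; last by move=> s' _ _ X1 Y1 sX1 sY1; exists X1, Y1.
rewrite big_ord0 /fn /fn2 big1 ?sqrtr0 // => r _.
by rewrite big1 // => c _; rewrite subrr sq0.
Qed.

Lemma err_inv_step k B X Y (s := nth 0%N sigma k) : (k < L.-1)%N -> err_inv k B ->
  optimal L N (alv beta) (dev beta) s B X Y -> fs 0 s X -> fs s L Y ->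
  err_inv k.+1 (fmul (N s) X Y).
Proof.
move=> kL [e1 e2] opt sX sY; have [s0L sk] := sigma_nth kL; rewrite -/s in s0L sk.
have sL : (s <= L)%N by case/andP: s0L => _ /ltnW.
split; last first.
  move=> s' s'L; rewrite (take_nth 0%N) ?size_sigma // mem_rcons in_cons => /norP[ns nk].
  move=> X1 Y1 sX1 sY1; have [X2 [Y2 [sX2 sY2 le2]]] := e2 s' s'L nk _ _ sX1 sY1.
  have s'LL : (s' <= L)%N by case/andP: s'L => _ /ltnW.
  have [ss'|s's] := leqP s s'.
    have [|X3 sX3 le3] := optimal_contract_left IFA _ opt sX sY sX2 sY2; first by rewrite ss'.
    by exists X3, Y2; split=> //; apply: le_trans le3 le2.
  have [|Y3 sY3 le3] := optimal_contract_right IFA _ opt sX sY sX2 sY2; first by rewrite ltnW.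
  by exists X2, Y3; split=> //; apply: le_trans le3 le2.
rewrite big_ord_recr /=; apply: le_trans (fn_triangle _ _ _ B _) _; apply: lerD => //.
have s1 : (0 < s <= L)%N by case/andP: s0L => -> /ltnW.
have s2 : (s < L <= L)%N by case/andP: s0L => _ ->; rewrite leqnn.
(* The new error is below the value of every pair in the set defining [Eerr]; the zero pair shows
   that this set is nonempty. *)
apply: lb_le_inf.
  have fs0 u t : fs u t (fun _ _ => 0) by move=> i j; rewrite eqxx.
  pose X0 : mxs R := mkx (N 0) (N s) (fun _ _ => 0).
  pose Y0 : mxs R := mkx (N s) (N L) (fun _ _ => 0).
  exists (frob (subx A (mulx X0 Y0))), X0, Y0; split=> //.
    by apply/(is_factorE L_gt0 arch chain nred _ s1)/isfac_mkx.
  by apply/(is_factorE L_gt0 arch chain nred _ s2)/isfac_mkx.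
move=> _ [X1 [Y1 [fX1 fY1 ->]]].
have [_ cX1 sX1] := (is_factorE L_gt0 arch chain nred X1 s1).1 fX1.
have [_ _ sY1] := (is_factorE L_gt0 arch chain nred Y1 s2).1 fY1.
rewrite frob_sub ent_mulx cX1 /fn ler_wsqrtr //.
have [X2 [Y2 [sX2 sY2 le2]]] := e2 s s0L sk _ _ sX1 sY1.
exact: le_trans (optimal_le IFA sL opt sX sY sX2 sY2) le2.
Qed.

Definition ends (st : state) := map (fun e => e.1.2) st.

(** Recording the interval ends ensures that a cut not yet treated lies strictly inside its
    interval. *)
Definition inv k (st : state) :=
  [/\ wf 0 st L, size st = k.+1,
      (forall x, (x \in ends st) = (x == L) || (x \in take k sigma)) &
      err_inv k (stprod 0 st)].

Lemma wf_fun u st v v' : wf u st v -> wf u st v' -> v = v'.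
Proof.
by elim: st u => [|[[q t] X] st IH] u /= => [-> //|[_ _ _ h] [_ _ _]]; apply: IH.
Qed.

Lemma wf_find u st v s : wf u st v -> (u < s <= v)%N ->
  exists st1 w t X st2, [/\ st = st1 ++ ((w.+1, t), X) :: st2, (w < s <= t)%N,
    wf u st1 w & wf t st2 v].
Proof.
elim: st u => [|[[q t] X] st IH] u /=; first by move=> ->; lia.
case=> -> ut fX w us; have [st'|ts] := leqP s t.
  by exists [::], u, t, X, st; split=> //; case/andP: us => -> _.
have [|st1 [w' [t' [X' [st2 [-> h1 h2 h3]]]]]] := IH t w; first by case/andP: us => _ ->; rewrite ts.
by exists (((u.+1, t), X) :: st1), w', t', X', st2.
Qed.

Lemma bstep_inv k st st' : (k < L.-1)%N -> inv k st ->
  bstep beta k.+1 (nth 0%N sigma k) st st' -> inv k.+1 st'.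
Proof.
move=> kL [w sst est eB]; set s := nth 0%N sigma k.
have [s0L sk] := sigma_nth kL; rewrite -/s in s0L sk.
case=> j [jst [qst [st1 [st2 [col [row [X [Y [tf ->]]]]]]]]].
have c0 : corth beta 0 (stprod 0 [::]).
  move=> i i' iN i'N _ /=; rewrite (bigD1 (Ordinal iN)) //= eqxx iN conjc1 mul1r.
  rewrite big1 ?addr0 ?andbT // => r nr'.
  have /negPf -> : nat_of_ord r != i by apply: contra nr' => /eqP e; apply/eqP/val_inj.
  by rewrite conjc0 mul0r.
have [a1 [b1 [u []]]] := col_pass L_gt0 arch chain nred
  (st1 := [::]) erefl erefl erefl w c0 col.
rewrite add0n => e1 sa1 wa1 wb1 oa1.
have [w1 m1 p1] := ortho_pass_inv L_gt0 arch chain nred w col.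
have [w2 m2 p2] := ortho_pass_inv L_gt0 arch chain nred w1 row.
have sst1 : size st1 = k.+1 by rewrite -(size_map fst) m1 size_map.
have j0 : (0 < j)%N by case/andP: jst.
have r0 : rorth beta L (stprod L [::]).
  move=> i i' iN i'N _ /=; rewrite (bigD1 (Ordinal iN)) //= eqxx iN conjc1 mul1r.
  rewrite big1 ?addr0 ?i'N ?andbT 1?eq_sym // => r nr'.
  have /negPf -> : i != nat_of_ord r by apply: contra nr' => /eqP e; apply/eqP/val_inj.
  by rewrite conjc0 mul0r.
have jk : size st1 = (j + (k.+1 - j))%N by rewrite sst1; move: jst; rewrite sst; lia.
have [a2 [b2 [v [e2 sa2 wa2 wb2 [ob2 tk]]]]] := row_pass L_gt0 arch chain nred
  (st1 := st1) (st2 := [::]) j0 (esym (cats0 _)) jk w1 erefl r0 row.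
have ta1 : take j.-1 st2 = a1 by rewrite tk e1 take_size_cat.
(* The row pass leaves [a1], of length [j - 1], in place, so [a2], of length [j], has one more
   entry: the interval to be split. *)
have [e ea2] : exists e, a2 = a1 ++ [:: e].
  have : size (drop j.-1 a2) = 1%N by rewrite size_drop sa2; lia.
  case ed : (drop j.-1 a2) => [|e [|? ?]] // _; exists e.
  rewrite -(cat_take_drop j.-1 a2) ed; congr (_ ++ _).
  by rewrite -ta1 e2 takel_cat // sa2 leq_pred.
move: wa2; rewrite ea2 wf_cat => -[u' [wa1' we]].
have eu := wf_fun wa1' wa1; subst u'.
case: e ea2 we => [[q t] M] ea2 /= [eq ut fM tv]; subst q t.
have vL := wf_le wb2.
have est2 : st2 = a1 ++ ((u.+1, v), M) :: b2 by rewrite e2 ea2 -catA.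
have nthj (T : Type) (d : T) (f : _ -> T) : nth d (map f st2) j.-1 = f ((u.+1, v), M).
  by rewrite est2 map_cat nth_cat size_map sa1 ltnn subnn.
have jS : (j.-1 < size st)%N by case/andP: jst => _; rewrite -{1}(prednK j0).
have enth : (nth (dflt_entry R) st j.-1).1 = (u.+1, v).
  rewrite -(nth_map _ (0, 0)%N fst) // -m1 -m2; exact: nthj.
have eM : (nth (dflt_entry R) st2 j.-1).2 = M.
  by rewrite est2 nth_cat sa1 ltnn subnn.
rewrite eM ta1 in tf *; rewrite enth /= in qst tf *.
have -> : drop j st2 = b2 by rewrite e2 drop_size_cat.
have ends2 : ends st2 = ends st.
  by rewrite /ends !(map_comp snd fst) m2 m1.
have usv : (u < s)%N by case/andP: qst.
(* [bstep] only gives [s <= v]; equality would make [s] an interval end, that is, [L] or a cut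
   already made. *)
have sv : (s < v)%N.
  rewrite ltn_neqAle; case/andP: (qst) => _ ->; rewrite andbT.
  apply/eqP => sv; have : s \in ends st.
    by rewrite -ends2 est2 /ends map_cat mem_cat in_cons /= -sv eqxx orbT.
  rewrite est (negPf sk) orbF; case/andP: s0L => _ /[swap] /eqP ->.
  by rewrite ltnn.
have [fX fY opt] := twofactorP L_gt0 arch chain nred usv sv vL tf.
have wr : wf u [:: ((u.+1, s), X), ((s.+1, v), Y) & b2] L by [].
have svL : (s <= v <= L)%N by rewrite ltnW.
have [_ _ sX] := fX; have [_ _ sY] := fY; have [_ _ sM] := fM.
have sF := fsupp_stprod L_gt0 arch chain nred wa1 (leq_trans (ltnW usv) (ltnW (leq_trans sv vL))).
have sG := fsupp_stprod L_gt0 arch chain nred wb2 (leqnn _).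
have pB : stprod 0 st = fmul (N u) (stprod 0 a1) (fmul (N v) (ent M) (stprod v b2)).
  rewrite -p1 -p2 est2.
  have wr2 : wf u (((u.+1, v), M) :: b2) L by [].
  by rewrite (stprod_cat L_gt0 arch chain nred wa1 wr2).
have pB' : stprod 0 (a1 ++ [:: ((u.+1, s), X), ((s.+1, v), Y) & b2]) =
    fmul (N s) (fmul (N u) (stprod 0 a1) (ent X)) (fmul (N v) (ent Y) (stprod v b2)).
  rewrite (stprod_cat L_gt0 arch chain nred wa1 wr) //=.
  by apply: funext => r; apply: funext => c; rewrite fmulA.
have sL : (s <= L)%N by case/andP: svL; apply: leq_trans.
split.
- by apply/wf_cat; exists u.
- have : size st2 = k.+1 by rewrite -(size_map fst) m2 size_map.
  by rewrite est2 !size_cat /= !addnS => ->.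
- move=> x; rewrite (take_nth 0%N) ?size_sigma // mem_rcons in_cons -/s orbCA -est -ends2 est2.
  by rewrite /ends !map_cat !mem_cat /= !in_cons; case: (x == s); rewrite ?orbT.
- rewrite pB'; apply: err_inv_step => //.
  + exact: eB.
  + move=> i iN; rewrite pB; apply: (bopt_sandwich IFA (ltnW usv) svL iN) => //.
    exact: opt.
  + by apply: (fsupp_fmul IFA _ _ sF sX); rewrite ?sL ?(ltnW usv).
  + by apply: (fsupp_fmul IFA _ _ sY sG); rewrite ?leqnn ?vL ?(ltnW sv).
Qed.

Lemma bstep_ex k st : (k < L.-1)%N -> inv k st ->
  exists st', bstep beta k.+1 (nth 0%N sigma k) st st'.
Proof.
move=> kL [w sst est eB]; set s := nth 0%N sigma k.
have [s0L sk] := sigma_nth kL; rewrite -/s in s0L sk.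
have sL : (0 < s <= L)%N by case/andP: s0L => -> /ltnW.
have [a [u [t [X [b [e ust wa wb]]]]]] := wf_find w sL.
have tL := wf_le wb.
have st0 : (s < t)%N.
  rewrite ltn_neqAle; case/andP: (ust) => _ ->; rewrite andbT.
  apply/eqP => ts; have : s \in ends st.
    by rewrite e /ends map_cat mem_cat in_cons /= -ts eqxx orbT.
  rewrite est (negPf sk) orbF; case/andP: s0L => _ /[swap] /eqP ->.
  by rewrite ltnn.
have us : (u < s)%N by case/andP: ust.
have aS : (size a < size st)%N by rewrite e size_cat /= addnS ltnS leq_addr.
have [|st1 col] := @ortho_pass_ex R beta L_gt0 arch chain nred OCol (iota 1 (size a)) st w.
  by move=> i; rewrite mem_iota => /andP[-> /leq_trans]; apply; rewrite add1n.
have [w1 m1 _] := ortho_pass_inv L_gt0 arch chain nred w col.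
have s1 : size st1 = k.+1 by rewrite -(size_map fst) m1 size_map.
have [|st2 row] := @ortho_pass_ex R beta L_gt0 arch chain nred ORow
    (rev (iota (size a).+1 (k.+1 - (size a).+1))) st1 w1.
  move=> i; rewrite mem_rev mem_iota subnKC -?s1; last by rewrite s1 -sst.
  by case/andP=> /(leq_ltn_trans (leq0n _)) -> ->.
have [X' [Y' tf]] := twofactor_exists L_gt0 arch chain nred us st0 tL
  (nth (dflt_entry R) st2 (size a)).2.
have en : nth (dflt_entry R) st (size a) = ((u.+1, t), X).
  by rewrite e nth_cat ltnn subnn.
eexists; exists (size a).+1; rewrite /= en; split=> //; split; first by [].
by exists st1, st2; split=> //; split=> //; exists X', Y'; split.
Qed.

(** Here [wf] may fail because [A] is arbitrary. With one interval there are no passes, and the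
    two-factor step is optimal for [A] directly; its output is supported, so the invariant starts at
    1. *)
Lemma first_bstep st' : bstep beta 1 (nth 0%N sigma 0) [:: ((1, L)%N, A)] st' -> inv 1 st'.
Proof.
have kL : (0 < L.-1)%N by rewrite -ltnS prednK.
have [s0L _] := sigma_nth kL; set s := nth 0%N sigma 0 in s0L *.
case=> j [/= j1 [_ [st1 [st2]]]].
have -> : j = 1%N by apply/eqP; rewrite eqn_leq andbC.
rewrite /= => -[-> [-> [X [Y [/= tf ->]]]]].
have [s0 sL] := andP s0L.
have [fX fY opt] := twofactorP L_gt0 arch chain nred s0 sL (leqnn _) tf.
have [_ _ sX] := fX; have [_ cY sY] := fY.
split=> //=.
- move=> x; rewrite (take_nth 0%N) ?size_sigma // take0 /= -/s mem_seq1 !in_cons in_nil orbF.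
  by rewrite orbC.
- rewrite fmul_idr; last by move=> i i' /ent_neq0[_]; rewrite cY.
  exact: (err_inv_step kL err_inv0).
Qed.

Lemma first_bstep_ex : exists st', bstep beta 1 (nth 0%N sigma 0) [:: ((1, L)%N, A)] st'.
Proof.
have kL : (0 < L.-1)%N by rewrite -ltnS prednK.
have [/andP[s0 sL] _] := sigma_nth kL.
have [X [Y tf]] := twofactor_exists L_gt0 arch chain nred s0 sL (leqnn _) A.
eexists; exists 1%N; split=> //=; split; first by rewrite s0 ltnW.
by exists [:: ((1, L)%N, A)], [:: ((1, L)%N, A)]; do 2!split=> //; exists X, Y.
Qed.

Lemma run n k st : (k + n = L.-1)%N -> inv k st ->
  (exists stf, rel_seq (fun J => bstep beta J (nth 0%N sigma J.-1)) (iota k.+1 n) st stf) /\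
  forall stf, rel_seq (fun J => bstep beta J (nth 0%N sigma J.-1)) (iota k.+1 n) st stf ->
    inv L.-1 stf.
Proof.
elim: n k st => [|n IH] k st kn hi /=.
  by rewrite addn0 in kn; split=> [|stf ->]; [exists st|rewrite -kn].
have kL : (k < L.-1)%N by rewrite -kn addnS ltnS leq_addr.
have kn' : (k.+1 + n = L.-1)%N by rewrite addSnnS.
split.
  have [st' h] := bstep_ex kL hi.
  have [[stf h'] _] := IH _ _ kn' (bstep_inv kL hi h).
  by exists stf, st'.
move=> stf [st' [h]]; have [_] := IH _ _ kn' (bstep_inv kL hi h); apply.
Qed.

(** Each interval uses at least one interface, so as many intervals as available steps forces all of
    them to have length one. *)
Lemma wf_full u st v : wf u st v -> (u + size st = v)%N -> forall i, (i < size st)%N ->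
  let e := nth (dflt_entry R) st i in
  e.1 = (u + i.+1, u + i.+1)%N /\ isf (u + i) (u + i).+1 e.2.
Proof.
elim: st u => [//|[[q t] X] st IH] u /= [-> ut fX w] sz.
have := wf_size w => tv.
have et : t = u.+1 by apply/eqP; rewrite eqn_leq ut andbT -(leq_add2r (size st)) addSnnS sz.
subst t; case=> [|i] iS /=; first by rewrite addn0 addn1.
by have := IH _ w _ i iS; rewrite !addSnnS; apply.
Qed.

Lemma inv_final st : inv L.-1 st ->
  in_Sigma beta (map snd st) /\
  frob (subx A (prodx (map snd st))) <=
    \sum_(k < L.-1) Eerr beta (nth 0%N sigma k) A.
Proof.
move=> [w sst _ [e _]]; rewrite prednK // in sst; split.
  split; first by rewrite size_map.
  move=> [//|l] /andP[_ lL] /=.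
  have sz : (0 + size st = L)%N by rewrite add0n.
  have lS : (l < size st)%N by rewrite sst.
  have [_ f] := wf_full w sz lS; rewrite add0n in f.
  rewrite (nth_map (dflt_entry R)) ?sst //.
  have lL' : (l < l.+1 <= L)%N by rewrite ltnSn.
  have -> : pat beta l.+1 = prodpat beta l.+1 l.+1 by rewrite /prodpat subnn.
  by apply/(is_factorE L_gt0 arch chain nred _ lL').
rewrite frob_sub; apply: le_trans e.
case: st w sst => [|[[q t] X] st] /=; first by move=> _ e0; have := L_gt0; rewrite -e0.
move=> [_ _ [rX cX sX] w] _; rewrite (stprod_prodx w) //.
Qed.

End Run.

Theorem theorem7p2 (R : realType) (beta : seq pattern) (sigma : seq nat)
    (m n : nat) (A : 'M[R[i]]_(m, n)) :
  (2 <= size beta)%N ->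
  is_arch beta -> chainable_arch beta -> ~ redundant_arch beta ->
  m = (pa (pat beta 1) * pb (pat beta 1) * pd (pat beta 1))%N ->
  n = (pa (pat beta (size beta)) * pc (pat beta (size beta)) * pd (pat beta (size beta)))%N ->
  perm_eq sigma (iota 1 (size beta).-1) ->
  (exists out, butterfly beta sigma (MX A) out) /\
  forall out, butterfly beta sigma (MX A) out ->
    in_Sigma beta out /\
    frob (subx (MX A) (prodx out)) <=
      \sum_(k < (size beta).-1) Eerr beta (nth 0%N sigma k) (MX A).
Proof.
move=> L2 arch chain nred hm hn sigmaP.
have rA : nr (MX A) = Nv beta 0 by [].
have cA : nc (MX A) = Nv beta (size beta) by rewrite /= hn; case: (size beta) L2.
have L1 : (size beta).-1 = (size beta).-2.+1 by lia.
have step := run L2 arch chain nred rA cA sigmaP (n := (size beta).-2) (k := 1).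
rewrite /butterfly L1 /=; split.
  have [st' h] := first_bstep_ex L2 arch chain nred (MX A) sigmaP.
  have [|[stf hf] _] := step st' _ (first_bstep L2 arch chain nred rA cA sigmaP h); first by lia.
  by exists (map snd stf), stf; split=> //; exists st'.
move=> _ [stf [[st' [h hf]] ->]].
have [|_ /(_ _ hf)] := step st' _ (first_bstep L2 arch chain nred rA cA sigmaP h); first by lia.
by rewrite -L1; apply: inv_final.
Qed.
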